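(* Let $f$ be a real function that is analytic on the closed unit interval $[0,1]$, and let the real parameters $q,w$ satisfy either ($q\in(-1,1]$ and $w\neq 0$) or ($q=-1$ and $w>0$). Assume $\int_0^1|f(u)|\,du<\infty$ and $\int_0^1|f(u)|(1+q u^n)^{w/n}\,du<\infty$. For positive integers $n$ let \[ I_n=I_n(q,w)=\int_0^1 f(u)\,(1+q\,u^n)^{w/n}\,du . \] Then, as $n\to\infty$, $I_n$ has the asymptotic expansion \[ I_n\sim \int_0^1 f(u)\,du+\sum_{p=2}^{\infty}\frac{a_p}{n^p}, \] where the coefficients $a_p=a_p(q,w)$ are \[ a_p=\sum_{\ell=1}^{p-1}(-w)^{p-\ell}\,\beta_{\ell-1}\,S_{\ell,p-\ell}(-q),\qquad \beta_\nu=(-1)^\nu\sum_{\ell=0}^{\nu}{\nu+1\brace \ell+1}f^{(\ell)}(1). \] In particular, for $q=-1$, \[ a_p=\sum_{\ell=1}^{p-1}(-w)^{p-\ell}\,\beta_{\ell-1}\,\zeta(\ell+1,\{1\}_{p-\ell-1}), \] and for $q=1$, \[ a_p=\sum_{\ell=1}^{p-1}(-w)^{p-\ell}\,\beta_{\ell-1}\,\zeta(\overline{\ell+1},\{1\}_{p-\ell-1}). \]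
   Context: ${n\brace k}$ denotes the Stirling numbers of the second kind. Nielsen's generalized polylogarithm is defined for positive integers $m,p$ by \[ S_{m,p}(z)=\frac{(-1)^{m+p-1}}{(m-1)!\,p!}\int_0^1\log^{m-1}(t)\,\log^{p}(1-zt)\,\frac{dt}{t}. \] Multiple zeta values: $\zeta(i_1,\dots,i_k)=\sum_{n_1>\dots>n_k\ge1}\frac{1}{n_1^{i_1}\cdots n_k^{i_k}}$; a bar over an exponent $i_j$ means the factor $(-1)^{n_j}$ is inserted in the numerator, e.g. $\zeta(\overline{m},\{1\}_{r})=\sum_{n_1>n_2>\dots>n_{r+1}\ge1}\frac{(-1)^{n_1}}{n_1^{m}n_2\cdots n_{r+1}}$. $\{1\}_r$ denotes the argument $1$ repeated $r$ times. ''$I_n\sim c_0+\sum_{p\ge2}a_p n^{-p}$'' means that for every $N\ge 2$, $I_n-c_0-\sum_{p=2}^N a_p n^{-p}=O(n^{-N-1})$ as $n\to\infty$. *)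

(* Defs.v *)
From HB Require Import structures.
From mathcomp Require Import all_boot all_order all_algebra.
From mathcomp Require Import all_classical all_reals all_analysis.

Set Implicit Arguments.
Unset Strict Implicit.
Unset Printing Implicit Defensive.

Import Order.TTheory GRing.Theory Num.Theory.
Import numFieldNormedType.Exports.

Local Open Scope classical_set_scope.
Local Open Scope ring_scope.

(* [f] is analytic in an open neighbourhood (in [R]) of [x0]; in particular its
   derivatives at an endpoint of an interval are ordinary two-sided ones. *)
Definition analytic_at (R : realType) (f : R -> R) (x0 : R) : Prop :=
  exists (c : nat -> R) (r : R), 0 < r /\
    forall x : R, `|x - x0| < r -> pseries c (x - x0) @ \oo --> f x.

Definition analytic_on (R : realType) (f : R -> R) (A : set R) : Prop :=
  forall x : R, A x -> analytic_at f x.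

Fixpoint stirling2 (n k : nat) : nat :=
  match n, k with
  | 0, 0 => 1
  | 0, _.+1 => 0
  | _.+1, 0 => 0
  | n'.+1, k'.+1 => k'.+1 * stirling2 n' k'.+1 + stirling2 n' k'
  end%N.

(* Meaningful for [0 < m], [0 < p] and [z <= 1].  The integrand may be singular
   at t = 0 and, when z = 1, at t = 1: the junk values [ln 0 = 0] and
   [0^-1 = 0] only affect these two points, a null set. *)
Definition nielsen_polylog (R : realType) (m p : nat) (z : R) : R :=
  (-1) ^+ (m + p).-1 / ((m.-1)`! * p`!)%:R *
  \int[@lebesgue_measure R]_(t in `[0, 1])
    (ln t ^+ m.-1 * ln (1 - z * t) ^+ p / t).

(* An argument of a multiple zeta value is a pair (b, i) of an exponent [i] and
   a flag [b] telling whether it is barred.  [mzv_trunc s N] is the finite sum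
   over N > n_1 > ... > n_k >= 1. *)
Fixpoint mzv_trunc (R : realType) (s : seq (bool * nat)) (N : nat) : R :=
  if s is (b, i) :: s' then
    \sum_(1 <= n < N)
      (if b then (-1) ^+ n else 1) / n%:R ^+ i * mzv_trunc R s' n
  else 1.

Definition mzv (R : realType) (s : seq (bool * nat)) : R :=
  limn (mzv_trunc R s).

Definition asymptotic_expansion (R : realType)
    (I_ : nat -> R) (c0 : R) (a : nat -> R) : Prop :=
  forall N : nat, (2 <= N)%N ->
    (fun n : nat => I_ n - c0 - \sum_(2 <= p < N.+1) a p / n%:R ^+ p)
      =O_\oo (fun n : nat => n%:R ^- N.+1 : R).

Definition I_int (R : realType) (f : R -> R) (q w : R) (n : nat) : R :=
  \int[@lebesgue_measure R]_(u in `[0, 1])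
    (f u * (1 + q * u ^+ n) `^ (w / n%:R)).

Definition beta_coef (R : realType) (f : R -> R) (nu : nat) : R :=
  (-1) ^+ nu *
  \sum_(0 <= l < nu.+1) (stirling2 nu.+1 l.+1)%:R * derive1n l f 1.

Definition a_coef (R : realType) (f : R -> R) (q w : R) (p : nat) : R :=
  \sum_(1 <= l < p)
    (- w) ^+ (p - l) * beta_coef f l.-1 * nielsen_polylog l (p - l) (- q).

(* Main.v *)
(* With l = ln (1 + q u^n), the factor
   (1 + q u^n)^(w/n) = exp (w l / n) is expanded to order N in l / n, and u f(u)
   is expanded at u = 1 in powers of L = - ln u, the coefficients being the
   derivatives at s = 0 of e^s f(e^s), i.e. Stirling combinations of the
   f^(l)(1).  On the whole of ]0, 1[ the error is at most a sum of terms
   n^(-k) L^(N-k) |l|^k / u with 1 <= k <= N.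
   Everything is thus reduced to the integrals of L^j (- l)^k / u.  Instead of
   changing variables, (- ln (1 - x))^k is expanded in a power series whose
   coefficients are nested harmonic sums and integrated termwise; the term
   u^(n m - 1) L^j integrates to j! / (n m)^(j+1).  So the integral scales as
   n^(-j-1), and at n = 1 it is both Nielsen's polylogarithm and, for q = -1 and
   q = 1, the multiple zeta value. *)
Require Import Defs.
From HB Require Import structures.
From mathcomp Require Import all_boot all_order all_algebra.
From mathcomp Require Import all_classical all_reals all_analysis.
From mathcomp Require Import measurable_realfun ring lra.
Import Order.TTheory GRing.Theory Num.Theory.
Import numFieldNormedType.Exports.
Local Open Scope classical_set_scope.
Local Open Scope ring_scope.

Set Implicit Arguments.
Unset Strict Implicit.
Unset Printing Implicit Defensive.

(** * Power series and analyticity *)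

(** Each of the [n.+1] copies of [rho ^+ n] is at most one term of the geometric sum. The bound is
    free of [n], so it absorbs the factor that termwise differentiation of a power series
    creates. *)
Lemma natmul_expr_le (R : realFieldType) (rho : R) (n : nat) :
  0 <= rho < 1 -> n.+1%:R * rho ^+ n <= (1 - rho)^-1.
Proof.
move=> /andP[r0 r1].
rewrite -[leRHS]mul1r ler_pdivlMr ?subr_gt0//.
have -> : n.+1%:R * rho ^+ n * (1 - rho) =
    (1 - rho) * \sum_(i < n.+1) rho ^+ n.
  by rewrite sumr_const card_ord mulr_natl mulrC.
apply: (@le_trans _ _ ((1 - rho) * \sum_(i < n.+1) rho ^+ i)); last first.
  have := subrX1 rho n.+1; move/eqP; rewrite -[1 - rho]opprB mulNr => /eqP <-.
  by rewrite opprB gerBl exprn_ge0.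
apply: ler_wpM2l; first by rewrite subr_ge0 ltW.
apply: ler_sum => i _; apply: ler_wiXn2l; rewrite // ?(ltW r1)// -ltnS//.
Qed.

(** For [t] strictly between the moduli of [z] and [x], the factor [n.+1] is absorbed by the [n]-th
    power of [|z| / t], which leaves a comparison with the absolutely convergent series at [t]. *)
Lemma is_cvg_pseries_diffs (R : realType) (c : nat -> R) (x z : R) :
  cvgn (pseries c x) -> `|z| < `|x| -> cvgn (pseries (pseries_diffs c) z).
Proof.
move=> cx zx; have [t /andP[zt tx]] : exists t : R, `|z| < t < `|x|.
  by exists ((`|z| + `|x|) / 2); rewrite !midf_lt.
have t0 : 0 < t by exact: le_lt_trans zt.
have ct : cvgn (pseries (fun i => `|c i|) t).
  by apply: is_cvg_pseries_inside_norm cx _; rewrite gtr0_norm.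
apply: normed_cvg.
(* The constant is the bound of [natmul_expr_le] at [|z| / t]; the extra [1 / t] compensates the
   shift of the exponent from [i] to [i.+1]. *)
have /= ct' : cvgn (series (fun i => (1 - `|z| / t)^-1 / t * (`|c i.+1| * t ^+ i.+1))).
  apply: is_cvg_seriesZ.
  rewrite /pseries in ct.
  have : cvgn (fun n => series (fun i => `|c i| * t ^+ i) n.+1 - `|c 0%N| * t ^+ 0).
    apply: is_cvgB; last exact: is_cvg_cst.
    have /cvg_ex[l cl] := ct; apply/cvg_ex; exists l.
    by rewrite (cvg_shiftS (series (fun i => `|c i| * t ^+ i))).
  rewrite [X in cvgn X -> _](_ : _ = series (fun i => `|c i.+1| * t ^+ i.+1))//.
  apply/funext => n; rewrite /series/= big_nat_recl//= addrC addKr.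
  by [].
apply: series_le_cvg ct'.
- by move=> n /=.
- move=> n /=; rewrite !mulr_ge0 ?invr_ge0 ?exprn_ge0 ?(ltW t0)//.
  by rewrite subr_ge0 ler_pdivrMr ?mul1r ?ltW.
- move=> n /=; rewrite /pseries_diffs !normrM normrX ger0_norm//.
  have zE : `|z| ^+ n = (`|z| / t) ^+ n * t ^+ n.
    by rewrite -exprMn divfK// gt_eqF.
  have := @natmul_expr_le R (`|z| / t) n.
  rewrite divr_ge0 ?(ltW t0)//= ltr_pdivrMr// mul1r => /(_ zt) H.
  rewrite zE exprSr.
  have -> : n.+1%:R * `|c n.+1| * ((`|z| / t) ^+ n * t ^+ n) =
    (n.+1%:R * (`|z| / t) ^+ n) * (`|c n.+1| * t ^+ n) by ring.
  have -> : (1 - `|z| / t)^-1 / t * (`|c n.+1| * (t ^+ n * t)) =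
    (1 - `|z| / t)^-1 * (`|c n.+1| * t ^+ n).
    by field; rewrite ?gt_eqF//= ?subr_gt0//.
  by rewrite ler_wpM2r// mulr_ge0// exprn_ge0// ltW.
Qed.

Lemma is_derive_pseries (R : realType) (c : nat -> R) (r x : R) :
  (forall y, `|y| < r -> cvgn (pseries c y)) -> `|x| < r ->
  is_derive x (1 : R) (fun y => limn (pseries c y))
    (limn (pseries (pseries_diffs c) x)).
Proof.
move=> cr xr.
have r0 : 0 < r by exact: le_lt_trans xr.
(* Three radii [|x| < s 1 < s 2 < s 3 < r]: the series and its first two formal derivatives must
   converge at one point beyond [x], and each differentiation costs a strictly smaller radius. *)
pose s i := `|x| + (r - `|x|) * i / 4.
have sE i : 0 <= s i -> `|s i| = s i by move=> ?; rewrite ger0_norm.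
have rx : 0 < r - `|x| by rewrite subr_gt0.
have x0 : 0 <= `|x| by [].
have s1 : `|s 1| = s 1 by rewrite sE// /s; nra.
have s2 : `|s 2| = s 2 by rewrite sE// /s; nra.
have s3 : `|s 3| = s 3 by rewrite sE// /s; nra.
have c3 : cvgn (pseries c (s 3)) by apply: cr; rewrite s3 /s; nra.
have d2 : cvgn (pseries (pseries_diffs c) (s 2)).
  by apply: is_cvg_pseries_diffs c3 _; rewrite s2 s3 /s; nra.
apply: (@pseries_snd_diffs _ _ (s 1)).
- by apply: is_cvg_pseries_inside c3 _; rewrite s1 s3 /s; nra.
- by apply: is_cvg_pseries_inside d2 _; rewrite s1 s2 /s; nra.
- by apply: is_cvg_pseries_diffs d2 _; rewrite s1 s2 /s; nra.
- by rewrite s1 /s; nra.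
Qed.

(** The series differentiates termwise at every point of the ball, not only at its centre. So the
    formal derivative represents [derive1 f] on the same ball, and the result can be iterated. *)
Lemma analytic_at_derive (R : realType) (f : R -> R) (x0 : R) :
  analytic_at f x0 -> derivable f x0 1 /\ analytic_at (derive1 f) x0.
Proof.
move=> [c [r [r0 fE]]].
have cr y : `|y| < r -> cvgn (pseries c y).
  move=> yr; have := fE (x0 + y); rewrite addrC addKr => /(_ yr).
  by move=> H; apply/cvg_ex; exists (f (x0 + y)).
have fD x : `|x - x0| < r ->
    is_derive x 1 f (limn (pseries (pseries_diffs c) (x - x0))).
  move=> xr; have := is_derive_pseries cr xr => D.
  have D1 : is_derive x 1 (fun y => y - x0) 1.
    by apply: is_derive_eq; rewrite subr0.
  have := @is_derive1_comp _ (fun y => limn (pseries c y)) (fun y => y - x0) x _ _ D D1.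
  rewrite mulr1; apply: near_eq_is_derive.
  near=> y; rewrite /comp/=; apply/cvg_lim => //; apply: fE.
  rewrite (_ : y - x0 = (y - x) + (x - x0)); last by ring.
  apply: le_lt_trans (ler_normD _ _) _; rewrite -ltrBrDr distrC.
  by near: y; apply: nbhsx_ballx; rewrite subr_gt0.
split.
  by have [] := fD x0; rewrite ?subrr ?normr0.
exists (pseries_diffs c), r; split=> // x xr.
have [_] := fD x xr; rewrite -derive1E => ->.
have [t /andP[t1 t2]] : exists t : R, `|x - x0| < t < r.
  by exists ((`|x - x0| + r) / 2); rewrite !midf_lt.
have t0 : 0 <= t by apply/ltW/(le_lt_trans _ t1).
apply: (@is_cvg_pseries_diffs _ c t); last by rewrite (ger0_norm t0).
by apply: cr; rewrite ger0_norm.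
Unshelve. all: by end_near. Qed.

(** * Differentiation rules for functions written pointwise *)

Lemma is_derive_mulp (R : realType) (f g : R -> R) (x a b : R) :
  is_derive x (1 : R) f a -> is_derive x (1 : R) g b ->
  is_derive x (1 : R) (fun y => f y * g y) (a * g x + f x * b).
Proof.
move=> df dg; apply: (is_derive_eq (is_deriveM df dg)).
by rewrite /GRing.scale/= addrC [g x * a]mulrC.
Qed.

Lemma is_derive_addp (R : realType) (f g : R -> R) (x a b : R) :
  is_derive x (1 : R) f a -> is_derive x (1 : R) g b ->
  is_derive x (1 : R) (fun y => f y + g y) (a + b).
Proof. exact: is_deriveD. Qed.

Lemma is_derive_subp (R : realType) (f g : R -> R) (x a b : R) :
  is_derive x (1 : R) f a -> is_derive x (1 : R) g b ->
  is_derive x (1 : R) (fun y => f y - g y) (a - b).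
Proof. exact: is_deriveB. Qed.

Lemma is_derive_cmulp (R : realType) (f : R -> R) (c x a : R) :
  is_derive x (1 : R) f a -> is_derive x (1 : R) (fun y => c * f y) (c * a).
Proof. exact: is_deriveZ. Qed.

Lemma is_derive_expp (R : realType) (f : R -> R) (n : nat) (x a : R) :
  is_derive x (1 : R) f a ->
  is_derive x (1 : R) (fun y => f y ^+ n) (n%:R * f x ^+ n.-1 * a).
Proof. by move=> df; have := is_deriveX n df; rewrite exprfctE. Qed.

(** * Powers of the logarithm *)

(* The coefficient of [x ^+ m] in [(- ln (1 - x)) ^+ k.+1 / k.+1`!]; the junk
   value [0^-1 = 0] makes the one of [x ^+ 0] vanish. *)
Definition lnpow_coef (R : realType) (k m : nat) : R :=
  mzv_trunc R (nseq k (false, 1%N)) m / m%:R.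

(** The added terms are those whose largest index is [m]. At [m = 0] both truncations are empty and
    [0^-1 = 0] makes the correction vanish. *)
Lemma mzv_trunc_ones_recr (R : realType) (k m : nat) :
  mzv_trunc R (nseq k.+1 (false, 1%N)) m.+1 =
  mzv_trunc R (nseq k.+1 (false, 1%N)) m + lnpow_coef R k m.
Proof.
rewrite /=; case: m => [|m].
  by rewrite !big_geq// /lnpow_coef invr0 mulr0 addr0.
by rewrite big_nat_recr//= expr1 /lnpow_coef mul1r mulrC.
Qed.

Lemma mzv_trunc_ones_ge0 (R : realType) (k m : nat) :
  0 <= mzv_trunc R (nseq k (false, 1%N)) m.
Proof.
elim: k m => [|k IH] m //=; apply: sumr_ge0 => i _.
by rewrite !mulr_ge0 ?invr_ge0 ?exprn_ge0.
Qed.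

Lemma lnpow_coef_ge0 (R : realType) (k m : nat) : 0 <= lnpow_coef R k m.
Proof. by rewrite mulr_ge0 ?invr_ge0// mzv_trunc_ones_ge0. Qed.

(* [half_rising m] grows like the square root of [m]. Both it and
   [half_rising m / m] satisfy telescoping recurrences, which bounds the nested
   harmonic sums and makes their series with weights [m ^- 2] converge. *)
Definition half_rising (R : realType) (m : nat) : R :=
  \prod_(1 <= i < m) (1 + 2^-1 / i%:R).

Lemma half_rising_recr (R : realType) (m : nat) :
  half_rising R m.+1 = half_rising R m * (1 + 2^-1 / m%:R).
Proof.
case: m => [|m]; first by rewrite /half_rising !big_geq// invr0 mulr0 addr0 mul1r.
by rewrite /half_rising big_nat_recr.
Qed.

Lemma half_rising_gt0 (R : realType) (m : nat) : 0 < half_rising R m.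
Proof.
by rewrite /half_rising; apply: prodr_gt0 => i _; rewrite ltr_pwDl// divr_ge0.
Qed.

Lemma half_rising_le (R : realType) (m : nat) : half_rising R m.+1 <= m.+1%:R.
Proof.
elim: m => [|m IH]; first by rewrite /half_rising big_geq.
rewrite half_rising_recr.
apply: (@le_trans _ _ (m.+1%:R * (1 + 2^-1 / m.+1%:R))).
  by apply: ler_wpM2r IH; rewrite addr_ge0// divr_ge0.
rewrite mulrDr mulr1 mulrCA divff ?pnatr_eq0// mulr1 -[m.+2]addn1 natrD.
by rewrite lerD2l invf_le1// ler1n.
Qed.

(** Induction on the depth, then on the truncation. The increment of [2 ^+ k.+1 * half_rising R m]
    is exactly [2 ^+ k * half_rising R m / m%:R], the bound that depth [k] gives for
    [lnpow_coef R k m]; each level costs a factor 2 because of the [2^-1] in [half_rising]. *)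
Lemma mzv_trunc_ones_le (R : realType) (k m : nat) :
  mzv_trunc R (nseq k (false, 1%N)) m <= 2 ^+ k * half_rising R m.
Proof.
elim: k m => [|k IH] m.
  rewrite expr0 mul1r; elim: m => [|m]; first by rewrite /half_rising big_geq.
  move=> /= /le_trans; apply; rewrite half_rising_recr ler_peMr//.
    by rewrite ltW// half_rising_gt0.
  by rewrite lerDl divr_ge0.
elim: m => [|m IHm].
  by rewrite /= big_geq// mulr_ge0 ?exprn_ge0// ltW// half_rising_gt0.
rewrite mzv_trunc_ones_recr half_rising_recr mulrDr mulr1 mulrDr lerD//.
rewrite /lnpow_coef mulrA exprS -mulrA [2 * _]mulrC.
have -> : 2 ^+ k * 2 * (half_rising R m * (2^-1 / m%:R)) =
  2 ^+ k * half_rising R m / m%:R by move: m%:R^-1 => y; field.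
by rewrite ler_wpM2r// ?invr_ge0.
Qed.

Lemma lnpow_coef_le (R : realType) (k m : nat) : lnpow_coef R k m <= 2 ^+ k.
Proof.
case: m => [|m]; first by rewrite /lnpow_coef invr0 mulr0 exprn_ge0.
rewrite /lnpow_coef ler_pdivrMr//.
apply: le_trans (mzv_trunc_ones_le _ _ _) _.
by rewrite ler_wpM2l ?exprn_ge0// half_rising_le.
Qed.

Lemma is_cvg_series_half_rising (R : realType) :
  cvgn (series (fun m => half_rising R m / m%:R ^+ 2)).
Proof.
apply: nondecreasing_is_cvgn.
  apply/nondecreasing_seqP => n; rewrite seriesSr lerDl.
  by rewrite divr_ge0 ?exprn_ge0// ltW// half_rising_gt0.
exists 4 => _ [n _ <-].
(* From [m] to [m + 1], [half_rising R m / m%:R] drops by [half_rising R m] over [2 m (m + 1)].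
   Since [m + 1 <= 2 m], four times this drop covers the term with weight [m ^- 2], and the drops
   telescope. *)
suff H m : series (fun m => half_rising R m / m%:R ^+ 2) m.+1 <=
    4 * (1 - half_rising R m.+1 / m.+1%:R).
  case: n => [|n]; first by rewrite /series/= big_geq.
  apply: le_trans (H n) _; rewrite ler_piMr// gerBl.
  by rewrite divr_ge0// ltW// half_rising_gt0.
elim: m => [|m IH].
  rewrite /series/= big_nat1 mulr0n expr0n invr0 mulr0 /half_rising big_geq//.
  by rewrite divr1 subrr mulr0.
rewrite seriesSr; apply: le_trans (lerD IH (lexx _)) _.
rewrite (half_rising_recr _ m.+1).
set P := half_rising R m.+1; have P0 : 0 < P by exact: half_rising_gt0.
rewrite -[m.+2]addn1 natrD; set x := m.+1%:R.
have x1 : 1 <= x by rewrite ler1n.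
rewrite -subr_ge0.
have -> : 4 * (1 - P * (1 + 2^-1 / x) / (x + 1)) - (4 * (1 - P / x) + P / x ^+ 2) =
   P * (x - 1) / (x ^+ 2 * (x + 1)).
  by field; rewrite !gt_eqF//=; lra.
by rewrite divr_ge0// ?mulr_ge0// ?exprn_ge0//; lra.
Qed.

(** The coefficient already holds one factor [1 / m], so even [j = 0] leaves the weight [m ^- 2].
    This convergence without geometric decay is what covers [q = 1] and [q = -1]. *)
Lemma is_cvg_series_lnpow (R : realType) (k j : nat) :
  cvgn (series (fun m => lnpow_coef R k m / m%:R ^+ j.+1)).
Proof.
have := is_cvg_seriesZ (k := 2 ^+ k) (@is_cvg_series_half_rising R).
apply: series_le_cvg.
- by move=> n; rewrite divr_ge0// ?exprn_ge0// lnpow_coef_ge0.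
- move=> n /=; rewrite mulr_ge0 ?exprn_ge0// divr_ge0 ?exprn_ge0// ltW//.
  exact: half_rising_gt0.
- case=> [|n] /=.
    rewrite /lnpow_coef invr0 mulr0 mul0r mulr_ge0 ?exprn_ge0//.
    by rewrite divr_ge0 ?exprn_ge0// ltW// half_rising_gt0.
  rewrite [leRHS](_ : _ = 2 ^+ k * half_rising R n.+1 / n.+1%:R ^+ 2); last first.
    by rewrite -mulrA.
  rewrite /lnpow_coef -[leLHS]mulrA -invfM -exprS.
  apply: ler_pM; rewrite ?mzv_trunc_ones_ge0 ?mzv_trunc_ones_le ?invr_ge0//.
  rewrite lef_pV2 ?posrE ?exprn_gt0//.
  by apply: ler_weXn2l; rewrite ?ler1n.
Qed.

Lemma is_cvg_pseries_bounded (R : realType) (c : nat -> R) (M x : R) :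
  (forall n, `|c n| <= M) -> `|x| < 1 -> cvgn (pseries c x).
Proof.
move=> cM x1; apply: normed_cvg.
have : cvgn (series (geometric M `|x|)).
  by apply: is_cvg_geometric_series; rewrite normr_id.
apply: series_le_cvg.
- by move=> n /=.
- by move=> n /=; rewrite mulr_ge0 ?exprn_ge0// (le_trans _ (cM 0%N)).
- by move=> n /=; rewrite normrM normrX ler_wpM2r// exprn_ge0.
Qed.

Lemma is_cvg_pseries_lnpow (R : realType) (k : nat) (x : R) :
  `|x| < 1 -> cvgn (pseries (lnpow_coef R k) x).
Proof.
apply: (@is_cvg_pseries_bounded _ _ (2 ^+ k)) => n.
by rewrite ger0_norm ?lnpow_coef_ge0 ?lnpow_coef_le.
Qed.

Lemma eq0_derive0_ball (R : realType) (h : R -> R) (r : R) :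
  (forall x, `|x| < r -> is_derive x (1 : R) h 0) -> h 0 = 0 ->
  forall x, `|x| < r -> h x = 0.
Proof.
move=> dh h0 x xr.
have sub (y : R) : `|y| <= `|x| -> `|y| < r by move=> yx; exact: le_lt_trans xr.
have cont a b : (forall z, z \in `[a, b] -> `|z| <= `|x|) ->
    {within `[a, b], continuous h}.
  move=> ab; apply: derivable_within_continuous => z zab.
  by have [] := dh z (sub _ (ab _ zab)).
have [->//|] := eqVneq x 0.
rewrite neq_lt => /orP[x0|x0].
- have H z : z \in `[x, 0] -> `|z| <= `|x|.
    by rewrite in_itv/= => /andP[xz z0]; rewrite !ler0_norm ?(ltW x0)// lerN2.
  have [|z _] := @MVT _ h (cst 0) _ _ x0 _ (cont _ _ H).
    by move=> z /subset_itv_oo_cc/H/sub; exact: dh.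
  by rewrite h0 mul0r sub0r => /eqP; rewrite oppr_eq0 => /eqP.
- have H z : z \in `[0, x] -> `|z| <= `|x|.
    by rewrite in_itv/= => /andP[z0 xz]; rewrite !ger0_norm ?(ltW x0).
  have [|z _] := @MVT _ h (cst 0) _ _ x0 _ (cont _ _ H).
    by move=> z /subset_itv_oo_cc/H/sub; exact: dh.
  by rewrite h0 mul0r subr0.
Qed.

Lemma pseries_diffs_lnpow (R : realType) (k m : nat) :
  pseries_diffs (lnpow_coef R k) m =
  mzv_trunc R (nseq k (false, 1%N)) m.+1.
Proof. by rewrite /pseries_diffs /lnpow_coef mulrCA divff ?mulr1// pnatr_eq0. Qed.

(** Multiplication by [1 - x] takes differences of consecutive coefficients, and the differences of
    nested harmonic sums are the coefficients one level lower. This is the differential equation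
    linking successive powers of the logarithm; level 0 is the geometric series. *)
Lemma cvg_pseries_lnpow_diffs (R : realType) (k : nat) (x : R) : `|x| < 1 ->
  (1 - x) * limn (pseries (pseries_diffs (lnpow_coef R k)) x) =
  if k is k'.+1 then limn (pseries (lnpow_coef R k') x) else 1.
Proof.
move=> x1; case: k => [|k].
  have -> : pseries_diffs (lnpow_coef R 0) = cst 1.
    by apply/funext => m; rewrite pseries_diffs_lnpow.
  have -> : pseries (cst 1) x = series (geometric 1 x) by [].
  rewrite (cvg_lim _ (cvg_geometric_series x1))// mulrC divfK//.
  by rewrite subr_eq0 eq_sym; apply: contraTneq x1 => ->; rewrite normr1 ltxx.
have [t /andP[xt t1]] : exists t : R, `|x| < t < 1.
  by exists ((`|x| + 1) / 2); rewrite !midf_lt.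
have t0 : `|t| = t by rewrite ger0_norm// (le_trans _ (ltW xt)).
have cD : cvgn (pseries (pseries_diffs (lnpow_coef R k.+1)) x).
  apply: (@is_cvg_pseries_diffs _ _ t); rewrite ?t0//.
  by apply: is_cvg_pseries_lnpow; rewrite t0.
have cL := @is_cvg_pseries_lnpow _ k _ x1.
(* [u n] is the boundary term of the summation by parts; it tends to 0 because, up to a shift and a
   factor [x], it is the general term of a convergent series. *)
pose u m := mzv_trunc R (nseq k.+1 (false, 1%N)) m * x ^+ m.
have u0 : u @ \oo --> 0.
  rewrite -cvg_shiftS.
  have -> : (fun n => u n.+1) =
      (fun n => pseries_diffs (lnpow_coef R k.+1) n * x ^+ n * x).
    by apply/funext => m; rewrite pseries_diffs_lnpow /u exprSr mulrA.
  have u0 : (fun n => pseries_diffs (lnpow_coef R k.+1) n * x ^+ n * x) @ \oo -->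
      0 * x.
    by apply: cvgM (cvg_cst x); exact: cvg_series_cvg_0 cD.
  by rewrite mul0r in u0.
have vE : (fun n => (1 - x) * pseries (pseries_diffs (lnpow_coef R k.+1)) x n)
    = (fun n => pseries (lnpow_coef R k) x n - u n).
  apply/funext => n; rewrite /pseries/=.
  elim: n => [|n IH].
    by rewrite /series/= !big_geq// mulr0 /u /= big_geq// mul0r subr0.
  rewrite !seriesSr mulrDr IH pseries_diffs_lnpow /u mzv_trunc_ones_recr exprSr.
  by ring.
have H1 : (fun n => (1 - x) * pseries (pseries_diffs (lnpow_coef R k.+1)) x n)
    @ \oo --> (1 - x) * limn (pseries (pseries_diffs (lnpow_coef R k.+1)) x).
  by apply: cvgM cD; exact: cvg_cst.
have H2 : (fun n => pseries (lnpow_coef R k) x n - u n) @ \oo -->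
    limn (pseries (lnpow_coef R k) x) - 0 by exact: cvgB.
by rewrite subr0 -vE in H2; exact: cvg_unique H1 H2.
Qed.

Lemma limn_pseries_lnpow (R : realType) (k : nat) (x : R) : `|x| < 1 ->
  limn (pseries (lnpow_coef R k) x) = (- ln (1 - x)) ^+ k.+1 / k.+1`!%:R.
Proof.
(* Both sides vanish at 0 and have the same derivative. *)
suff step j : (forall y : R, `|y| < 1 ->
    (1 - y) * limn (pseries (pseries_diffs (lnpow_coef R j)) y) =
    (- ln (1 - y)) ^+ j / j`!%:R) ->
  forall y : R, `|y| < 1 ->
    limn (pseries (lnpow_coef R j) y) = (- ln (1 - y)) ^+ j.+1 / j.+1`!%:R.
  elim: k x => [|k IH] x x1; apply: step => // y y1.
    by rewrite cvg_pseries_lnpow_diffs// expr0 divr1.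
  by rewrite cvg_pseries_lnpow_diffs// IH.
move=> H y y1; apply/eqP; rewrite -subr_eq0; apply/eqP; move: y y1.
apply: eq0_derive0_ball => [y y1|]; last first.
  rewrite subr0 ln1 oppr0 expr0n/= mul0r subr0; apply/cvg_lim => //.
  rewrite -cvg_shiftS; apply: cvg_near_cst; near=> n.
  rewrite /pseries /series/= big_nat_recl//= big1 ?addr0.
    by rewrite /lnpow_coef invr0 mulr0 mul0r.
  by move=> i _; rewrite expr0n mulr0.
have y_lt1 : 0 < 1 - y by rewrite subr_gt0 (le_lt_trans (ler_norm _)).
have D1 : is_derive y (1 : R) (fun x : R => limn (pseries (lnpow_coef R j) x))
    (limn (pseries (pseries_diffs (lnpow_coef R j)) y)).
  by apply: is_derive_pseries y1 => z; exact: is_cvg_pseries_lnpow.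
have D2 : is_derive y (1 : R) (fun x : R => 1 - x) (- 1).
  rewrite -[- 1]sub0r.
  exact: (is_deriveB (is_derive_cst (1 : R) y (1 : R)) (is_derive_id y (1 : R))).
have D3 := @is_derive1_comp _ (@ln R) (fun x => 1 - x) y _ _
  (is_derive1_ln y_lt1) D2.
have D4 : is_derive y (1 : R) (fun x : R => - 1 * ln (1 - x)) _ :=
  is_derive_cmulp (-1) D3.
have D5 := is_derive_subp D1 (is_derive_cmulp (j.+1`!%:R)^-1 (is_derive_expp j.+1 D4)).
rewrite (_ : (fun z : R => _ - _) = (fun z : R => limn (pseries (lnpow_coef R j) z) -
    j.+1`!%:R^-1 * (- 1 * ln (1 - z)) ^+ j.+1)); last first.
  by apply/funext => z; rewrite mulN1r [_ / _]mulrC.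
apply: (is_derive_eq D5).
have -> : limn (pseries (pseries_diffs (lnpow_coef R j)) y) =
    (- ln (1 - y)) ^+ j / j`!%:R / (1 - y).
  by rewrite -H// mulrC mulKf// gt_eqF.
rewrite factS natrM mulN1r/=; field.
by rewrite (gt_eqF y_lt1) nat1r !pnatr_eq0 /= andbT -lt0n fact_gt0.
Unshelve. all: by end_near. Qed.

(** * Termwise integration *)

Lemma expr_fact_le_expR (R : realType) (x : R) (i : nat) :
  0 <= x -> x ^+ i / i`!%:R <= expR x.
Proof.
move=> x0; apply: (@le_trans _ _ (series (exp_coeff x) i.+1)).
  rewrite seriesSr lerDr /series/= sumr_ge0// => k _.
  by rewrite exp_coeff_ge0.
apply: nondecreasing_cvgn_le; last exact: is_cvg_series_exp_coeff.
by apply/nondecreasing_seqP => n; rewrite seriesSr lerDl exp_coeff_ge0.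
Qed.

(** In the variable [t = - b.+1 * ln v] the function is [exp (- t)] times a partial exponential sum,
    an incomplete gamma function. Its derivative telescopes to the last term. *)
Lemma is_derive_incomplete_gamma (R : realType) (j b : nat) (u : R) : 0 < u ->
  is_derive u (1 : R)
    (fun v : R => v ^+ b.+1 * \sum_(i < j.+1) (b.+1%:R * - ln v) ^+ i / i`!%:R)
    (b.+1%:R * u ^+ b * ((b.+1%:R * - ln u) ^+ j / j`!%:R)).
Proof.
move=> u0; have Dln := is_derive1_ln u0.
have Dx := is_derive_expp b.+1 (is_derive_id u (1 : R)).
elim: j => [|j IH].
  rewrite (_ : (fun v => _) = (fun v : R => v ^+ b.+1)); last first.
    apply/funext => v; rewrite big_ord1 (_ : _ / _ = 1) ?mulr1//.
    exact: divr1.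
  by apply: (is_derive_eq Dx); rewrite [in RHS](_ : _ / _ = 1)//; exact: divr1.
have Dl := is_derive_cmulp (j.+1`!%:R)^-1
  (is_derive_expp j.+1 (is_derive_cmulp (- b.+1%:R) Dln)).
rewrite (_ : (fun v => _) = (fun v : R =>
    v ^+ b.+1 * (\sum_(i < j.+1) (b.+1%:R * - ln v) ^+ i / i`!%:R) +
    v ^+ b.+1 * (j.+1`!%:R^-1 * (- b.+1%:R * ln v) ^+ j.+1))); last first.
  by apply/funext => v; rewrite big_ord_recr/= mulrDr mulrN mulNr [_ / _]mulrC.
apply: (is_derive_eq (is_derive_addp IH (is_derive_mulp Dx Dl))) => /=.
rewrite factS natrM !exprS !mulNr !mulrN; field.
by rewrite (gt_eqF u0) nat1r !pnatr_eq0 /= ?andbT -lt0n fact_gt0.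
Qed.

(** The primitive [E] gives the integral over [[u_ n, 1]], and these intervals exhaust []0, 1]]. The
    integrand is nonnegative there, so monotone convergence yields the value before integrability is
    known. *)
Lemma integral_lnpow_expr (R : realType) (j b : nat) :
  (\int[@lebesgue_measure R]_(u in `]0%R, 1%R[)
    ((- ln u) ^+ j * u ^+ b)%:E = (j`!%:R / b.+1%:R ^+ j.+1)%:E)%E.
Proof.
pose f (u : R) := (- ln u) ^+ j * u ^+ b.
have mf : measurable_fun setT f.
  apply: measurable_funM; last exact: exprn_measurable.
  by apply: measurable_funX; apply: measurableT_comp => //; exact: measurable_ln.
pose E (v : R) := (j`!%:R / b.+1%:R ^+ j.+1) *
  (v ^+ b.+1 * \sum_(i < j.+1) (b.+1%:R * - ln v) ^+ i / i`!%:R).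
have dE (u : R) : 0 < u -> is_derive u (1 : R) E (f u).
  move=> u0; have D := is_derive_incomplete_gamma j b u0.
  have B0 : b.+1%:R != 0 :> R by rewrite pnatr_eq0.
  have F0 : j`!%:R != 0 :> R by rewrite pnatr_eq0 -lt0n fact_gt0.
  apply: (is_derive_eq (is_derive_cmulp _ D)); rewrite exprMn /f exprS.
  move: (b.+1%:R : R) B0 (j`!%:R : R) F0 => B B0 F F0.
  by field; rewrite F0 B0 expf_neq0.
(* The factor 2 splits [u_ n ^+ b.+1] into two copies of [expR (- y)]: one beats the power [y ^+ i],
   the other tends to 0. *)
pose u_ n : R := expR (- (2 * n.+1%:R)).
have u0 n : 0 < u_ n by exact: expR_gt0.
have u1 n : u_ n < 1 by rewrite expR_lt1 oppr_lt0 mulr_gt0.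
have E1 : E 1 = j`!%:R / b.+1%:R ^+ j.+1.
  rewrite /E ln1 oppr0 mulr0 expr1n mul1r big_ord_recl expr0 fact0 divr1.
  by rewrite big1 ?addr0 ?mulr1// => i _; rewrite expr0n/= mul0r.
have Ecvg : E (u_ n) @[n --> \oo] --> 0.
  pose C := (j`!%:R / b.+1%:R ^+ j.+1) * \sum_(i < j.+1) (2 : R) ^+ i.
  have H : (fun n => C * expR (- n%:R)) @ \oo --> 0.
    rewrite -[X in _ --> X](mulr0 C); apply: cvgM; first exact: cvg_cst.
    exact: cvgn_expR.
  apply: (squeeze_cvgr _ (cvg_cst 0) H); near=> n.
  have lnu : - ln (u_ n) = 2 * n.+1%:R by rewrite /u_ expRK opprK.
  rewrite /E lnu; apply/andP; split.
    rewrite !mulr_ge0 ?invr_ge0 ?exprn_ge0 ?(ltW (u0 n))//.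
    by apply: sumr_ge0 => i _; rewrite divr_ge0// exprn_ge0// mulr_ge0.
  rewrite /C -[leRHS]mulrA; apply: ler_wpM2l.
    by rewrite divr_ge0// exprn_ge0.
  rewrite mulr_sumr mulr_suml; apply: ler_sum => i _.
  pose y : R := b.+1%:R * n.+1%:R.
  have -> : u_ n ^+ b.+1 = expR (- y) * expR (- y).
    by rewrite /u_ -expRM_natl -expRD; congr expR; rewrite /y; ring.
  have -> : (b.+1%:R * (2 * n.+1%:R)) ^+ i / i`!%:R = 2 ^+ i * (y ^+ i / i`!%:R) :> R.
    by rewrite /y [RHS]mulrA -exprMn; congr (_ ^+ _ / _); ring.
  rewrite mulrCA ler_wpM2l ?exprn_ge0// -mulrA.
  apply: (@le_trans _ _ (expR (- y) * (expR (- y) * expR y))).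
    rewrite !ler_wpM2l ?expR_ge0// expr_fact_le_expR//.
    by rewrite /y mulr_ge0.
  rewrite -expRD addNr expR0 mulr1 ler_expR lerN2 /y -natrM ler_nat.
  by rewrite (leq_trans (leqnSn n))// leq_pmull.
have U : \bigcup_n `[u_ n, (1:R)]%classic = `]0, 1]%classic.
  apply/seteqP; split => [x [n _]|x] /=; rewrite !in_itv/=.
    by move=> /andP[ux ->]; rewrite (lt_le_trans (u0 n)).
  move=> /andP[x0 x1].
  have [n nx] : exists n : nat, - ln x <= n%:R.
    by exists (Num.truncn (- ln x)).+1; apply/ltW/truncnS_gt.
  exists n => //=; rewrite in_itv/= x1 andbT -(@lnK _ x)// ler_expR.
  rewrite lerNl (le_trans nx)// -natrM ler_nat.
  by rewrite (leq_trans (leqnSn n))// leq_pmull.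
transitivity (\int[@lebesgue_measure R]_(u in `]0%R, 1%R]) (f u)%:E)%E.
  rewrite (integral_itv_bndoo false false)//.
  by apply/measurable_EFinP; exact: measurable_funTS.
have H : (\int[@lebesgue_measure R]_(x in `[u_ n, 1%R]) (f x)%:E)%E @[n --> \oo] -->
    (\int[@lebesgue_measure R]_(u in `]0%R, 1%R]) (f u)%:E)%E.
  rewrite -U; apply: ge0_nondecreasing_set_cvg_integral.
  - move=> n m nm; apply/subsetPset => x /=; rewrite !in_itv/= => /andP[ux ->].
    by rewrite andbT (le_trans _ ux)// ler_expR lerN2 ler_wpM2l// ler_nat.
  - by move=> n; exact: measurable_itv.
  - by move=> n; apply/measurable_EFinP; exact: measurable_funTS.
  - move=> n x /=; rewrite in_itv/= => /andP[ux x1]; rewrite lee_fin.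
    have x0 := lt_le_trans (u0 n) ux.
    by rewrite /f mulr_ge0 ?exprn_ge0 ?(ltW x0)// oppr_ge0 -ln1 ler_ln ?posrE.
have FTC n : (\int[@lebesgue_measure R]_(x in `[u_ n, 1%R]) (f x)%:E =
    (E 1 - E (u_ n))%:E)%E.
  rewrite EFinB; apply: continuous_FTC2 => //.
  - apply: derivable_within_continuous => x; rewrite in_itv/= => /andP[ux _].
    have Dln := is_derive1_ln (lt_le_trans (u0 n) ux).
    rewrite (_ : f = fun v => (-1 * ln v) ^+ j * v ^+ b); last first.
      by apply/funext => v; rewrite mulN1r.
    have [] // := is_derive_mulp (is_derive_expp j (is_derive_cmulp (-1) Dln))
      (is_derive_expp b (is_derive_id x (1 : R))).
  - have Ec x : 0 < x -> {for x, continuous E}.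
      move=> x0; apply: differentiable_continuous; apply/derivable1_diffP.
      by have [] := dE _ x0.
    split.
    + move=> x; rewrite in_itv/= => /andP[ux _].
      by have [] := dE _ (lt_trans (u0 n) ux).
    + by apply: cvg_at_right_filter; exact: Ec.
    + by apply: cvg_at_left_filter; exact: Ec.
  - move=> x; rewrite in_itv/= => /andP[ux _].
    by have [_] := dE _ (lt_trans (u0 n) ux); rewrite derive1E.
apply: (cvg_unique _ H) => //=.
under eq_cvg do rewrite FTC.
apply: cvg_EFin; first exact: nearW.
rewrite -E1 -[X in _ --> X]subr0.
by apply: cvgB => //; exact: cvg_cst.
Unshelve. all: by end_near. Qed.

(** Dominated convergence for the partial sums. The dominating function [g], the sum of the absolute
    values, takes extended real values and is integrable by monotone convergence. *)
Lemma Rintegral_series d (T : measurableType d) (R : realType)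
    (mu : {measure set T -> \bar R}) (D : set T) (f_ : nat -> T -> R)
    (F : T -> R) : measurable D ->
  (forall m, mu.-integrable D (EFin \o f_ m)) ->
  cvgn (series (fun m => \int[mu]_(x in D) `|f_ m x|)) ->
  (forall x, D x -> series (f_ ^~ x) @ \oo --> F x) ->
  mu.-integrable D (EFin \o F) /\
  series (fun m => \int[mu]_(x in D) f_ m x) @ \oo --> \int[mu]_(x in D) F x.
Proof.
move=> mD intf cvgf fF.
have mf m : measurable_fun D (f_ m) by exact/measurable_EFinP/measurable_int.
have mabs m : measurable_fun D (EFin \o (fun x => `|f_ m x|)).
  by apply/measurable_EFinP; exact: measurableT_comp.
pose g x : \bar R := (\sum_(m <oo) (`|f_ m x|)%:E)%E.
have ig : mu.-integrable D g.
  apply/integrableP; split.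
    apply: ge0_emeasurable_sum; last by move=> m _; exact: mabs.
    by move=> m x Dx _; rewrite lee_fin.
  rewrite (eq_integral g); last first.
    move=> x _; rewrite gee0_abs//.
    by apply: nneseries_ge0 => m _ _; rewrite lee_fin.
  rewrite integral_nneseries//.
  have -> : (\sum_(m <oo) \int[mu]_(x in D) (`|f_ m x|)%:E)%E =
      limn (EFin \o (series (fun m => \int[mu]_(x in D) `|f_ m x|))).
    congr (limn _); apply/funext => n; rewrite /series/= -sumEFin.
    apply: eq_bigr => m _; rewrite /Rintegral fineK//.
    by apply: integrable_fin_num => //; exact: integrable_norm.
  by rewrite EFin_lim// ltry.
pose h n x : \bar R := (series (f_ ^~ x) n)%:E.
have hE n : h n = (fun x => \sum_(0 <= m < n) (f_ m x)%:E)%E.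
  by apply/funext => x; rewrite /h /series/= -sumEFin.
have mh n : measurable_fun D (h n).
  rewrite hE; apply: emeasurable_sum => m; exact/measurable_EFinP.
have mF : measurable_fun D (EFin \o F).
  apply/measurable_EFinP; apply: (measurable_fun_cvg _ fF) => n.
  exact/measurable_EFinP/mh.
have [||iF _ cF] := @dominated_convergence _ _ _ mu D mD h (EFin \o F) g mh mF _ ig.
- by apply: aeW => x Dx; apply: cvg_EFin; [exact: nearW|exact: fF].
- apply: aeW => x n Dx; rewrite /h /= /g.
  apply: (@le_trans _ _ (\sum_(0 <= m < n) (`|f_ m x|)%:E)%E).
    by rewrite sumEFin lee_fin ler_norm_sum.
  by apply: nneseries_lim_ge => m _ _; rewrite lee_fin.
split => //.
have -> : series (fun m => \int[mu]_(x in D) f_ m x) =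
    fine \o (fun n => \int[mu]_(x in D) h n x)%E.
  apply/funext => n; rewrite /= hE integral_sum//.
  rewrite /series/= -[LHS]/(fine _%:E) -sumEFin; congr fine.
  apply: eq_bigr => m _; rewrite /Rintegral fineK//.
  exact: integrable_fin_num (intf m).
apply: fine_cvg; rewrite /Rintegral fineK//.
exact: integrable_fin_num iF.
Qed.

Lemma integrable_lnpow_expr (R : realType) (j b : nat) :
  (@lebesgue_measure R).-integrable `]0, 1[
    (EFin \o (fun u : R => (- ln u) ^+ j * u ^+ b)).
Proof.
apply/integrableP; split.
  apply/measurable_EFinP/measurable_funTS.
  apply: measurable_funM; last exact: exprn_measurable.
  by apply: measurable_funX; apply: measurableT_comp => //; exact: measurable_ln.
apply: (@le_lt_trans _ _ (j`!%:R / b.+1%:R ^+ j.+1)%:E); last exact: ltry.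
rewrite -integral_lnpow_expr le_eqVlt; apply/orP; left; apply/eqP.
apply: eq_integral => u; rewrite inE/= in_itv/= => /andP[u0 u1].
rewrite ger0_norm// mulr_ge0 ?exprn_ge0 ?(ltW u0)//.
by rewrite oppr_ge0 -ln1 ler_ln ?posrE ?ltW.
Qed.

Lemma Rintegral_lnpow_expr (R : realType) (j b : nat) :
  \int[@lebesgue_measure R]_(u in `]0, 1[) ((- ln u) ^+ j * u ^+ b) =
  j`!%:R / b.+1%:R ^+ j.+1.
Proof. by rewrite /Rintegral integral_lnpow_expr. Qed.

Lemma Rintegral_lnpow_pseries (R : realType) (c : nat -> R) (j n : nat)
    (F : R -> R) :
  (0 < n)%N -> c 0%N = 0 -> cvgn (series (fun m => `|c m| / m%:R ^+ j.+1)) ->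
  (forall u, 0 < u < 1 -> pseries c (u ^+ n) @ \oo --> F u) ->
  (@lebesgue_measure R).-integrable `]0, 1[
    (EFin \o (fun u => (- ln u) ^+ j * F u / u)) /\
  series (fun m => c m / m%:R ^+ j.+1) @ \oo -->
    n%:R ^+ j.+1 / j`!%:R *
    \int[@lebesgue_measure R]_(u in `]0, 1[) ((- ln u) ^+ j * F u / u).
Proof.
move=> n0 c0 cvgc cF.
have J0 : j`!%:R != 0 :> R by rewrite pnatr_eq0 -lt0n fact_gt0.
have N0 : n%:R ^+ j.+1 != 0 :> R by rewrite expf_neq0// pnatr_eq0 -lt0n.
(* The division by [u] lowers the exponent by one. At [m = 0] the predecessor is truncated, which is
   harmless as [c 0 = 0]. *)
pose f_ m (u : R) := c m * ((- ln u) ^+ j * u ^+ (n * m).-1).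
pose K : R := j`!%:R / n%:R ^+ j.+1.
have intE m : c m * (j`!%:R / (n * m).-1.+1%:R ^+ j.+1) = K * (c m / m%:R ^+ j.+1).
  have [->|m0] := eqVneq m 0%N; first by rewrite c0 !mul0r mulr0.
  rewrite prednK ?muln_gt0 ?n0 ?lt0n// natrM exprMn /K.
  by field; rewrite N0 expf_neq0// pnatr_eq0.
have int_f m : (@lebesgue_measure R).-integrable `]0, 1[ (EFin \o f_ m).
  rewrite (_ : EFin \o _ = (fun u => (c m)%:E *
    ((- ln u) ^+ j * u ^+ (n * m).-1)%:E)%E) //.
  by apply: integrableZl => //; exact: integrable_lnpow_expr.
have If m : \int[@lebesgue_measure R]_(u in `]0, 1[) f_ m u =
    K * (c m / m%:R ^+ j.+1).
  by rewrite RintegralZl ?Rintegral_lnpow_expr//; exact: integrable_lnpow_expr.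
have Iabs m : \int[@lebesgue_measure R]_(u in `]0, 1[) `|f_ m u| =
    K * (`|c m| / m%:R ^+ j.+1).
  transitivity (\int[@lebesgue_measure R]_(u in `]0, 1[)
      (`|c m| * ((- ln u) ^+ j * u ^+ (n * m).-1))).
    apply: eq_Rintegral => u; rewrite inE/= in_itv/= => /andP[u0 u1].
    rewrite /f_ normrM [X in _ * X]ger0_norm// mulr_ge0 ?exprn_ge0 ?(ltW u0)//.
    by rewrite oppr_ge0 -ln1 ler_ln ?posrE ?ltW.
  rewrite RintegralZl ?Rintegral_lnpow_expr//; last exact: integrable_lnpow_expr.
  have [->|m0] := eqVneq m 0%N; first by rewrite c0 normr0 !mul0r mulr0.
  rewrite prednK ?muln_gt0 ?n0 ?lt0n// natrM exprMn /K.
  by field; rewrite N0 expf_neq0// pnatr_eq0.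
have [|||int_F cvgF] := @Rintegral_series _ _ R lebesgue_measure `]0, 1[%classic f_
    (fun u => (- ln u) ^+ j * F u / u) _ int_f.
- by [].
- rewrite (_ : (fun m => _) = K *: (fun m => `|c m| / m%:R ^+ j.+1)).
    exact: is_cvg_seriesZ.
  by apply/funext => m; rewrite Iabs.
- move=> u /=; rewrite in_itv/= => u01; have /andP[u0 u1] := u01.
  have : (fun N => (- ln u) ^+ j * pseries c (u ^+ n) N / u) @ \oo -->
      (- ln u) ^+ j * F u / u.
    apply: cvgM; last exact: cvg_cst.
    by apply: cvgM (cF _ u01); exact: cvg_cst.
  apply: cvg_trans; apply: near_eq_cvg; near=> N.
  rewrite /pseries /series/= mulr_sumr mulr_suml; apply: eq_bigr => m _.
  have [->|m0] := eqVneq m 0%N; first by rewrite /f_ c0 !mul0r mulr0 mul0r.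
  rewrite /f_ -exprM -[in LHS](@prednK (n * m)%N) ?muln_gt0 ?n0 ?lt0n//.
  by rewrite exprS; field; rewrite gt_eqF.
split => //.
have -> : series (fun m => c m / m%:R ^+ j.+1) =
    (fun N => K^-1 * series (fun m => \int[lebesgue_measure]_(u in `]0, 1[) f_ m u) N).
  apply/funext => N; rewrite /series/= mulr_sumr; apply: eq_bigr => m _.
  by rewrite If mulKf// mulf_neq0// invr_neq0.
by rewrite -invf_div; apply: cvgM cvgF; exact: cvg_cst.
Unshelve. all: by end_near. Qed.

Lemma norm_lt1_mulr_expn (R : realType) (q u : R) (n : nat) :
  (0 < n)%N -> -1 <= q <= 1 -> 0 < u < 1 -> `|q * u ^+ n| < 1.
Proof.
move=> n0 q1 /andP[u0 u1]; rewrite normrM normrX (gtr0_norm u0).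
rewrite (@le_lt_trans _ _ (1 * u ^+ n))//.
  by rewrite ler_wpM2r ?exprn_ge0 ?(ltW u0)// ler_norml.
by rewrite mul1r exprn_ilt1 ?ltW// -lt0n.
Qed.

(** The series is free of [n]: comparing its limit at [n] and at 1 gives the scaling of the
    integral. *)
Lemma cvg_lnpow_integral (R : realType) (q : R) (j k n : nat) :
  (0 < n)%N -> -1 <= q <= 1 ->
  (@lebesgue_measure R).-integrable `]0, 1[
    (EFin \o (fun u => (- ln u) ^+ j * (- ln (1 + q * u ^+ n)) ^+ k.+1 / u)) /\
  series (fun m => lnpow_coef R k m * (- q) ^+ m / m%:R ^+ j.+1) @ \oo -->
    n%:R ^+ j.+1 / (j`! * k.+1`!)%:R *
    \int[@lebesgue_measure R]_(u in `]0, 1[)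
      ((- ln u) ^+ j * (- ln (1 + q * u ^+ n)) ^+ k.+1 / u).
Proof.
move=> n0 q1; pose K : R := k.+1`!%:R.
have K0 : K != 0 by rewrite pnatr_eq0 -lt0n fact_gt0.
have [|||int_F cvgF] := @Rintegral_lnpow_pseries R
  (fun m => K * (lnpow_coef R k m * (- q) ^+ m)) j n
  (fun u => (- ln (1 + q * u ^+ n)) ^+ k.+1) n0.
- by rewrite /lnpow_coef invr0 mulr0 mul0r mulr0.
- apply: (series_le_cvg _ _ _ (is_cvg_seriesZ (k := K) (@is_cvg_series_lnpow R k j))).
  + by move=> m; rewrite divr_ge0// exprn_ge0.
  + by move=> m; rewrite mulr_ge0// divr_ge0 ?exprn_ge0 ?lnpow_coef_ge0.
  + move=> m /=; rewrite [leRHS](_ : _ = K * (lnpow_coef R k m / m%:R ^+ j.+1))//.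
    rewrite [leRHS]mulrA ler_wpM2r ?invr_ge0 ?exprn_ge0//.
    rewrite normrM [`|K|]ger0_norm// ler_wpM2l// normrM.
    rewrite [`|lnpow_coef _ _ _|]ger0_norm ?lnpow_coef_ge0//.
    rewrite ler_piMr ?lnpow_coef_ge0// normrX normrN exprn_ile1//.
    by rewrite ler_norml.
- move=> u u01; have qu := norm_lt1_mulr_expn n0 q1 u01.
  have /(_ k) := @limn_pseries_lnpow R _ (- (q * u ^+ n)).
  rewrite normrN => /(_ qu); rewrite opprK => H.
  rewrite [X in _ --> X](_ : _ = K * limn (pseries (lnpow_coef R k) (- (q * u ^+ n)))).
    have : (fun N => K * pseries (lnpow_coef R k) (- (q * u ^+ n)) N) @ \oo -->
        K * limn (pseries (lnpow_coef R k) (- (q * u ^+ n))).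
      apply: cvgM; first exact: cvg_cst.
      by apply: is_cvg_pseries_lnpow; rewrite normrN.
    apply: cvg_trans; apply: near_eq_cvg; near=> N.
    rewrite /pseries /series/= mulr_sumr; apply: eq_bigr => m _.
    by rewrite -mulNr exprMn !mulrA.
  by rewrite H [RHS]mulrC divfK.
split => //.
have -> : series (fun m => lnpow_coef R k m * (- q) ^+ m / m%:R ^+ j.+1) =
  (fun N => K^-1 *
   series (fun m => K * (lnpow_coef R k m * (- q) ^+ m) / m%:R ^+ j.+1) N).
  apply/funext => N; rewrite /series/= mulr_sumr; apply: eq_bigr => m _.
  by rewrite !mulrA mulVf// mul1r.
rewrite natrM invfM (mulrC (j`!%:R^-1)) mulrA (mulrC (_ ^+ _)) -!mulrA.
by apply: cvgM; [exact: cvg_cst|rewrite mulrA].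
Unshelve. all: by end_near. Qed.

(** * Polylogarithms and multiple zeta values *)

(** The sign in the definition is the one that negates both logarithms, and the two endpoints form a
    null set. *)
Lemma nielsen_polylogE (R : realType) (q : R) (j k : nat) : -1 <= q <= 1 ->
  nielsen_polylog j.+1 k.+1 (- q) = (j`! * k.+1`!)%:R^-1 *
    \int[@lebesgue_measure R]_(u in `]0, 1[)
      ((- ln u) ^+ j * (- ln (1 + q * u)) ^+ k.+1 / u).
Proof.
move=> q1; have [int_F _] := @cvg_lnpow_integral R q j k 1 isT q1.
pose F (u : R) := (- ln u) ^+ j * (- ln (1 + q * u)) ^+ k.+1 / u.
have {}int_F : (@lebesgue_measure R).-integrable `]0, 1[ (EFin \o F).
  exact: int_F.
have FE u : ln u ^+ j * ln (1 - - q * u) ^+ k.+1 / u = (-1) ^+ (j + k.+1) * F u.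
  have sq n : (-1) ^+ n * (-1) ^+ n = 1 :> R.
    by rewrite -exprD addnn -mul2n exprM sqrrN !expr1n.
  rewrite /F mulNr opprK [(- ln u) ^+ j]exprNn [(- ln (1 + q * u)) ^+ k.+1]exprNn exprD.
  have := sq j; have := sq k.+1.
  move: ((-1) ^+ j : R) ((-1) ^+ k.+1 : R) => s t tt ss.
  transitivity (s * s * (t * t) * (ln u ^+ j * ln (1 + q * u) ^+ k.+1 / u)).
    by rewrite ss tt !mul1r.
  by ring.
have mF := measurable_int _ int_F.
rewrite /nielsen_polylog.
rewrite (_ : (fun t => _) = (fun u => (-1) ^+ (j + k.+1) * F u)); last first.
  by apply/funext => u; rewrite -FE.
have -> : \int[@lebesgue_measure R]_(u in `[0, 1]) ((-1) ^+ (j + k.+1) * F u) =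
    (-1) ^+ (j + k.+1) * \int[@lebesgue_measure R]_(u in `]0, 1[) F u.
  rewrite -RintegralZl// /Rintegral (integral_itv_bndoo true false)//.
  by apply/measurable_EFinP; apply: measurable_funM => //; exact/measurable_EFinP.
by rewrite mulrACA addSn/= -exprD addnn -mul2n exprM sqrrN !expr1n mul1r.
Qed.

Lemma cvg_nielsen_polylog (R : realType) (q : R) (j k : nat) : -1 <= q <= 1 ->
  series (fun m => lnpow_coef R k m * (- q) ^+ m / m%:R ^+ j.+1) @ \oo -->
    nielsen_polylog j.+1 k.+1 (- q).
Proof.
move=> q1; rewrite nielsen_polylogE//.
by have [_] := @cvg_lnpow_integral R q j k 1 isT q1; rewrite expr1n mul1r.
Qed.

Lemma Rintegral_lnpow_scale (R : realType) (q : R) (j k n : nat) :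
  (0 < n)%N -> -1 <= q <= 1 ->
  \int[@lebesgue_measure R]_(u in `]0, 1[)
    ((- ln u) ^+ j * (- ln (1 + q * u ^+ n)) ^+ k.+1 / u) =
  (j`! * k.+1`!)%:R / n%:R ^+ j.+1 * nielsen_polylog j.+1 k.+1 (- q).
Proof.
move=> n0 q1; have [_ cvg_n] := @cvg_lnpow_integral R q j k n n0 q1.
rewrite -(cvg_unique _ cvg_n (@cvg_nielsen_polylog R q j k q1))//.
rewrite -[X in _ * (X * _)]invf_div mulVKf//.
by rewrite mulf_neq0 ?invr_neq0 ?expf_neq0// pnatr_eq0 -lt0n ?muln_gt0 ?fact_gt0.
Qed.

(** Of the exponent [j.+2], one factor [1 / m] belongs to [lnpow_coef]. The series starts at index 0
    and the zeta sum at 1, but the coefficient of index 0 is 0. *)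
Lemma mzv_nielsen_polylog (R : realType) (b : bool) (j k : nat) :
  mzv R ((b, j.+2) :: nseq k (false, 1%N)) =
  nielsen_polylog j.+1 k.+1 (if b then -1 else 1).
Proof.
have H (s : R) : -1 <= s <= 1 ->
    (forall n, (if b then (-1) ^+ n else 1) = s ^+ n) ->
    mzv R ((b, j.+2) :: nseq k (false, 1%N)) = nielsen_polylog j.+1 k.+1 s.
  move=> s1 sE; have := @cvg_nielsen_polylog R (- s) j k.
  rewrite opprK lerNr lerNl opprK andbC => /(_ s1) /(cvg_lim _) <- //.
  rewrite /mzv; congr (limn _); apply/funext => -[|N] /=.
    by rewrite /series/= !big_geq.
  have L0 : lnpow_coef R k 0 = 0 by rewrite /lnpow_coef invr0 mulr0.
  rewrite /series/= [RHS]big_ltn// L0 !mul0r add0r.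
  rewrite !big_nat; apply: eq_bigr => m /andP[m0 _].
  have M0 : m%:R != 0 :> R by rewrite pnatr_eq0 -lt0n.
  by rewrite sE /lnpow_coef exprS; field; rewrite ?expf_neq0 ?M0.
case: b H => H; apply: H => //.
- by apply/andP; split; lra.
- by apply/andP; split; lra.
- by move=> n; rewrite expr1n.
Qed.

(** * Taylor expansions *)

(** The [G i] are successive derivatives of one function. The remainder of order [J.+1] of [G i] has
    as derivative the remainder of order [J] of [G i.+1], and the mean value theorem adds a factor
    [|s|]. The bound holds on a whole half-line, since [ln u] runs down to minus infinity. *)
Lemma taylor_chain_le (R : realType) (X : R) (G : nat -> R -> R) : 0 <= X ->
  (forall i s, s <= X -> is_derive s (1 : R) (G i) (G i.+1 s)) ->
  (forall i, exists M, forall s, s <= X -> `|G i s| <= M) ->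
  forall J i, exists2 C, 0 <= C & forall s, s <= X ->
    `|G i s - \sum_(j < J) G (i + j)%N 0 * (s ^+ j / j`!%:R)| <= C * `|s| ^+ J.
Proof.
move=> X0 dG bG; elim=> [|J IH] i.
  have [M GM] := bG i; exists M; first by rewrite (le_trans _ (GM 0 X0)).
  by move=> s sX; rewrite big_ord0 subr0 expr0 mulr1 GM.
have [C C0 HC] := IH i.+1; exists C => // s sX.
pose P v := \sum_(j < J.+1) G (i + j)%N 0 * (v ^+ j / j`!%:R).
pose dP v := \sum_(j < J) G (i.+1 + j)%N 0 * (v ^+ j / j`!%:R).
have dPE v : is_derive v (1 : R) P (dP v).
  have -> : P = (fun v => G i 0 +
      \sum_(j < J) (G (i.+1 + j)%N 0 / j.+1`!%:R) * v ^+ j.+1).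
    apply/funext => z; rewrite /P big_ord_recl addn0 (_ : _ / _ = 1); last exact: divr1.
    rewrite mulr1; congr (_ + _); apply: eq_bigr => j _.
    by rewrite /bump/= addnS addSn mulrA mulrAC.
  rewrite /dP -[X in is_derive _ _ _ X]add0r.
  apply: is_derive_addp.
  elim: J {IH HC P dP} => [|J IH].
    under eq_fun do rewrite big_ord0; rewrite big_ord0; exact: is_derive_cst.
  under eq_fun do rewrite big_ord_recr/=; rewrite big_ord_recr/=.
  apply: is_derive_addp => //.
  apply: (is_derive_eq (is_derive_cmulp _ (is_derive_expp _ (is_derive_id v (1 : R))))).
  rewrite mulr1 factS natrM/=; field.
  by rewrite nat1r !pnatr_eq0 -lt0n fact_gt0.
pose D v := G i v - P v.
have dD v : v <= X -> is_derive v (1 : R) D (G i.+1 v - dP v).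
  by move=> vX; exact: (is_derive_subp (dG i v vX) (dPE v)).
have D0 : D 0 = 0.
  rewrite /D /P big_ord_recl addn0 (_ : _ / _ = 1); last exact: divr1.
  by rewrite mulr1 big1 ?addr0 ?subrr// => j _; rewrite expr0n/= mul0r mulr0.
have cont a b : b <= X -> {within `[a, b], continuous D}.
  move=> bX; apply: derivable_within_continuous => z; rewrite in_itv/= => /andP[_ zb].
  by have [] := dD z (le_trans zb bX).
have bnd z : z <= X -> `|z| <= `|s| -> `|G i.+1 z - dP z| <= C * `|s| ^+ J.
  move=> zX zs; apply: le_trans (HC z zX) _.
  by rewrite ler_wpM2l// lerXn2r ?nnegrE.
rewrite -/(P s) -/(D s) exprSr mulrA.
have [->|] := eqVneq s 0; first by rewrite D0 normr0 mulr0.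
rewrite neq_lt => /orP[s0|s0].
- have [|z zs] := @MVT _ D (fun v => G i.+1 v - dP v) _ _ s0 _ (cont _ _ X0).
    move=> z; rewrite in_itv/= => /andP[_ z0].
    by apply: dD; rewrite (le_trans (ltW z0)).
  move: zs; rewrite in_itv/= => /andP[sz z0].
  rewrite D0 !sub0r => /eqP; rewrite eqr_oppLR => /eqP ->.
  rewrite normrN normrM normrN ler_wpM2r// bnd ?(le_trans (ltW z0))//.
  by rewrite !ltr0_norm// lerN2 ltW.
- have [|z zs] := @MVT _ D (fun v => G i.+1 v - dP v) _ _ s0 _ (cont _ _ sX).
    move=> z; rewrite in_itv/= => /andP[_ z0].
    by apply: dD; rewrite (le_trans (ltW z0)).
  move: zs; rewrite in_itv/= => /andP[z0 zs].
  rewrite D0 !subr0 => ->.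
  rewrite normrM ler_wpM2r// bnd ?(le_trans (ltW zs))//.
  by rewrite !gtr0_norm// ltW.
Qed.

Lemma expR_taylor_le (R : realType) (X : R) (J : nat) : 0 <= X ->
  exists2 C, 0 <= C & forall s, s <= X ->
    `|expR s - \sum_(j < J) s ^+ j / j`!%:R| <= C * `|s| ^+ J.
Proof.
move=> X0; have [|C C0 HC] := @taylor_chain_le R X (fun=> expR) X0 _ _ J 0.
  by move=> _; exists (expR X) => s sX; rewrite ger0_norm ?expR_ge0// ler_expR.
exists C => // s sX; apply: le_trans (HC s sX).
by under [X in _ <= `|_ - X|]eq_bigr do rewrite expR0 mul1r.
Qed.

Section euler_derivatives.
Variables (R : realType) (f : R -> R).
Hypothesis f_analytic : analytic_on f `[0, 1].

Lemma analytic_at_derive1n (l : nat) (x : R) : 0 <= x <= 1 ->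
  analytic_at (derive1n l f) x.
Proof.
move=> x01; elim: l => [|l IH]; first by apply: f_analytic; rewrite /= in_itv.
by have [_] := analytic_at_derive IH.
Qed.

Lemma is_derive_derive1n (l : nat) (x : R) : 0 <= x <= 1 ->
  is_derive x (1 : R) (derive1n l f) (derive1n l.+1 f x).
Proof.
move=> x01; have [df _] := analytic_at_derive (analytic_at_derive1n l x01).
by apply: DeriveDef => //; rewrite derive1nS derive1E.
Qed.

Lemma derive1n_bounded (l : nat) :
  exists M, forall x, 0 <= x <= 1 -> `|derive1n l f x| <= M.
Proof.
have cf : {within `[0, 1], continuous (fun x => `|derive1n l f x|)}.
  have : {within `[0, 1], continuous (derive1n l f)}.
    apply: derivable_within_continuous => x; rewrite in_itv/= => x01.
    by have [] := is_derive_derive1n l x01.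
  by move=> cf x; apply: continuous_comp; [exact: cf|exact: norm_continuous].
have [c _ H] := EVT_max ler01 cf.
by exists `|derive1n l f c| => x x01; apply: H; rewrite in_itv.
Qed.

(* The [j]-th derivative of [s |-> expR s * f (expR s)], expanded by the
   recurrence of the Stirling numbers. *)
Definition euler_derivative (j : nat) (s : R) : R :=
  \sum_(l < j.+1) (stirling2 j.+1 l.+1)%:R * (expR s ^+ l.+1 * derive1n l f (expR s)).

Lemma stirling2_gt (n k : nat) : (n < k)%N -> stirling2 n k = 0%N.
Proof.
elim: n k => [|n IH] [|k] //= nk.
by rewrite (IH k.+1 (ltnW nk)) (IH k nk) muln0.
Qed.

Lemma is_derive_euler_derivative (j : nat) (s : R) : s <= 0 ->
  is_derive s (1 : R) (euler_derivative j) (euler_derivative j.+1 s).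
Proof.
move=> s0; have e01 : 0 <= expR s <= 1 by rewrite expR_ge0 expR_le1.
pose t l : R := expR s ^+ l.+1 * derive1n l f (expR s).
have dt l : is_derive s (1 : R) (fun s => expR s ^+ l.+1 * derive1n l f (expR s))
    (l.+1%:R * t l + t l.+1).
  have De := is_derive_expR s.
  have Df : is_derive s (1 : R) (fun s => derive1n l f (expR s))
      (derive1n l.+1 f (expR s) * expR s).
    exact: is_derive1_comp (is_derive_derive1n l e01) De.
  apply: (is_derive_eq (is_derive_mulp (is_derive_expp l.+1 De) Df)).
  by rewrite /t /= !exprSr; ring.
have dsum m : is_derive s (1 : R)
    (fun s => \sum_(l < m) (stirling2 j.+1 l.+1)%:R *
       (expR s ^+ l.+1 * derive1n l f (expR s)))
    (\sum_(l < m) (stirling2 j.+1 l.+1)%:R * (l.+1%:R * t l + t l.+1)).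
  elim: m => [|m IH].
    under eq_fun do rewrite big_ord0; rewrite big_ord0; exact: is_derive_cst.
  under eq_fun do rewrite big_ord_recr/=; rewrite big_ord_recr/=.
  by apply: is_derive_addp => //; exact: is_derive_cmulp.
apply: (is_derive_eq (dsum j.+1)).
(* These two vanishing values let one sum be extended at the top and the other be shifted at the
   bottom, so that the Stirling recurrence applies term by term. *)
have st_gt : stirling2 j.+1 j.+2 = 0%N by exact: stirling2_gt.
have st_0 : stirling2 j.+1 0 = 0%N by [].
transitivity (\sum_(l < j.+2) ((l.+1 * stirling2 j.+1 l.+1)%:R * t l +
    (stirling2 j.+1 l)%:R * t l)); last first.
  by apply: eq_bigr => l _; rewrite -mulrDl -natrD.
move: (stirling2 j.+1) st_gt st_0 => st st_gt st_0.
under eq_bigr do rewrite mulrDr.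
rewrite !big_split; congr (_ + _).
  rewrite [RHS]big_ord_recr/= st_gt muln0 mul0r addr0.
  by apply: eq_bigr => l _; rewrite natrM; ring.
by rewrite [RHS]big_ord_recl/= st_0 mul0r add0r.
Qed.

(** The sign in [beta_coef] reflects the expansion in powers of [- ln u] instead of [ln u]. *)
Lemma euler_derivative0 (j : nat) :
  euler_derivative j 0 = (-1) ^+ j * beta_coef f j.
Proof.
rewrite /beta_coef mulrA -exprD addnn -mul2n exprM sqrrN !expr1n mul1r.
rewrite /euler_derivative big_mkord; apply: eq_bigr => l _.
by rewrite expR0 expr1n mul1r.
Qed.

Lemma analytic_taylor_ln_le (J : nat) : exists2 C, 0 <= C & forall u, 0 < u <= 1 ->
  `|u * f u - \sum_(j < J) beta_coef f j * ((- ln u) ^+ j / j`!%:R)| <=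
  C * (- ln u) ^+ J.
Proof.
have [||C C0 HC] := @taylor_chain_le R 0 euler_derivative (lexx _) _ _ J 0.
- by move=> i s s0; exact: is_derive_euler_derivative.
(* For [s <= 0] the point [expR s] stays in [[0, 1]], where all derivatives are bounded; hence a
   bound on the whole half-line. *)
- move=> i; have /choice[M HM] := derive1n_bounded.
  exists (\sum_(l < i.+1) (stirling2 i.+1 l.+1)%:R * M l) => s s0.
  have e01 : 0 <= expR s <= 1 by rewrite expR_ge0 expR_le1.
  apply: le_trans (ler_norm_sum _ _ _) _; apply: ler_sum => l _.
  rewrite normrM ger0_norm// ler_wpM2l// normrM normrX ger0_norm ?expR_ge0//.
  apply: le_trans (HM l _ e01); rewrite ler_piMl//.
  by have /andP[e0 e1] := e01; rewrite exprn_ile1.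
exists C => // u /andP[u0 u1].
have l0 : ln u <= 0 by rewrite -ln1 ler_ln ?posrE.
have := HC _ l0; rewrite (ler0_norm l0).
rewrite [euler_derivative 0 _](_ : _ = u * f u); last first.
  by rewrite /euler_derivative big_ord1/= lnK ?posrE// mul1r.
rewrite [X in _ - X](_ : _ = \sum_(j < J) beta_coef f j * ((- ln u) ^+ j / j`!%:R))//.
apply: eq_bigr => j _; rewrite add0n euler_derivative0 [(- ln u) ^+ _]exprNn.
by ring.
Qed.

End euler_derivatives.

(** * The asymptotic expansion *)

(** The substitution is [p = k + j + 2] and [l = j + 1]; each induction step adds one
    antidiagonal. *)
Lemma sum_triangle (V : nmodType) (F : nat -> nat -> V) (M : nat) :
  (\sum_(2 <= p < M.+2) \sum_(1 <= l < p) F (p - l)%N l.-1 =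
   \sum_(k < M) \sum_(j < M - k) F k.+1 j)%R.
Proof.
elim: M => [|M IH]; first by rewrite big_geq// big_ord0.
rewrite big_nat_recr//= IH.
transitivity (\sum_(k < M.+1) (\sum_(j < M - k) F k.+1 j + F k.+1 (M - k)%N));
    last first.
  apply: eq_bigr => k _; rewrite subSn ?big_ord_recr//.
  by rewrite -ltnS.
rewrite big_split/=; congr (_ + _).
  by rewrite big_ord_recr/= subnn big_ord0 addr0.
rewrite big_add1/= big_nat_rev/= big_mkord; apply: eq_bigr => k _.
by rewrite add0n !subSS subSn ?leq_subr// subKn// -ltnS.
Qed.

Lemma Rintegral_bigsum d (T : measurableType d) (R : realType)
    (mu : {measure set T -> \bar R}) (D : set T) (I : Type) (s : seq I)
    (f : I -> T -> R) : measurable D ->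
  (forall i, mu.-integrable D (EFin \o f i)) ->
  mu.-integrable D (EFin \o (fun x => \sum_(i <- s) f i x)) /\
  \int[mu]_(x in D) (\sum_(i <- s) f i x) = \sum_(i <- s) \int[mu]_(x in D) f i x.
Proof.
move=> mD intf; elim: s => [|i s [IHi IH]].
  rewrite (_ : (fun x => _) = cst 0); last by apply/funext => x; rewrite big_nil.
  split; last by rewrite big_nil Rintegral_cst// mul0r.
  exact: integrable0.
rewrite (_ : (fun x => _) = (fun x => f i x + \sum_(i <- s) f i x)); last first.
  by apply/funext => x; rewrite big_cons.
split.
  by apply: eq_integrable (integrableD mD (intf i) IHi).
by rewrite RintegralD// IH big_cons.
Qed.

Lemma integrable_oo_cc (R : realType) (f : R -> R) :
  measurable_fun (`]0, 1[%classic : set R) f ->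
  (\int[@lebesgue_measure R]_(u in `[0%R, 1%R]) (`|f u|%R)%:E < +oo)%E ->
  (@lebesgue_measure R).-integrable `]0, 1[ (EFin \o f) /\
  \int[@lebesgue_measure R]_(u in `[0, 1]) f u =
  \int[@lebesgue_measure R]_(u in `]0, 1[) f u.
Proof.
move=> mf; rewrite (integral_itv_bndoo true false); last first.
  by apply/measurable_EFinP; exact: measurableT_comp.
move=> foo; split; first by apply/integrableP; split; [exact/measurable_EFinP|].
by rewrite /Rintegral (integral_itv_bndoo true false)//; exact/measurable_EFinP.
Qed.

(** [1 + q * v] lies between [1 - v] and its inverse. Errors for any [q] are thus bounded by the
    case [q = -1]. *)
Lemma ln1Dq_bounds (R : realType) (q v : R) : -1 <= q <= 1 -> 0 < v < 1 ->
  0 < 1 + q * v /\ `|ln (1 + q * v)| <= - ln (1 - v).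
Proof.
move=> /andP[q1 q2] /andP[v0 v1].
have p1 : 0 < 1 - v by rewrite subr_gt0.
have p2 : 1 - v <= 1 + q * v by nra.
have p3 : 0 < 1 + q * v by exact: lt_le_trans p2.
split=> //; rewrite ler_norml opprK ler_ln ?posrE// p2/=.
rewrite -lnV ?posrE// ler_ln ?posrE ?invr_gt0//.
by rewrite -[leRHS]mul1r ler_pdivlMr//; nra.
Qed.

(** The upper bound is uniform in [n] and [v]. For [q > -1] the logarithm lies between 0 and
    [ln (1 + q)]. For [q = -1] it is unbounded below and [0 < w] keeps the product nonpositive; the
    right-hand side is then 0 because [ln 0 = 0]. *)
Lemma exponent_le (R : realType) (q w v : R) (n : nat) :
  (-1 < q <= 1 /\ w != 0) \/ (q = -1 /\ 0 < w) -> (0 < n)%N -> 0 < v < 1 ->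
  w / n%:R * ln (1 + q * v) <= `|w| * `|ln (1 + q)|.
Proof.
move=> qw n0 /andP[v0 v1].
have wn : `|w / n%:R| <= `|w|.
  by rewrite normrM normfV [`|n%:R|]ger0_norm// ler_piMr// invf_le1 ?ler1n// ltr0n.
case: qw => [[/andP[q1 q2] _]|[-> w0]].
  apply: le_trans (ler_norm _) _; rewrite normrM ler_pM//.
  have p1 : 0 < 1 + q by rewrite addrC -ltrBlDr sub0r.
  have [q0|q0] := leP 0 q.
    have qv : 0 <= q * v by rewrite mulr_ge0// ltW.
    have qv1 : q * v <= q by rewrite ler_piMr// ltW.
    rewrite !ger0_norm ?ler_ln ?posrE ?lerD2l//.
    - by rewrite ltr_wpDr.
    - by rewrite -ln1 ler_ln ?posrE ?lerDl//; lra.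
    - by rewrite -ln1 ler_ln ?posrE ?lerDl//; lra.
  have qv : q * v <= 0 by rewrite mulr_le0_ge0// ltW.
  have qv1 : q <= q * v by nra.
  have p2 : 0 < 1 + q * v by rewrite (lt_le_trans p1)// lerD2l.
  rewrite !ler0_norm ?lerN2 ?ler_ln ?posrE ?lerD2l//.
  - by rewrite -ln1 ler_ln ?posrE//; lra.
  - by rewrite -ln1 ler_ln ?posrE//; lra.
apply: (@le_trans _ _ 0); last by rewrite mulr_ge0.
rewrite mulr_ge0_le0//; first by rewrite divr_ge0// ltW.
by rewrite -ln1 ler_ln ?posrE//; lra.
Qed.

(** * Pointwise bound of the remainder *)

Section remainder.
Variables (R : realType) (f : R -> R) (q w : R).
Hypothesis f_analytic : analytic_on f `[0, 1].
Hypothesis qw : (-1 < q <= 1 /\ w != 0) \/ (q = -1 /\ 0 < w).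

Let q_bounds : -1 <= q <= 1.
Proof.
by case: qw => [[/andP[/ltW -> ->]]|[-> _]] //; apply/andP; split; lra.
Qed.

(** The parameter [s] is [q] in the terms of the expansion and [-1] in the error bound. *)
Definition log_kernel (s : R) (n j k : nat) (u : R) : R :=
  (- ln u) ^+ j * (- ln (1 + s * u ^+ n)) ^+ k / u.

(** The [k]-th term of the exponential series times the [j]-th Taylor term of [u * f u], divided by
    [u]. *)
Definition expansion_term (n k j : nat) (u : R) : R :=
  (- w) ^+ k * beta_coef f j / (j`! * k`!)%:R / n%:R ^+ k * log_kernel q n j k u.

(** The power [k.+1] of the exponent is paired with the Taylor polynomial of order [M - k]. Every
    error term then has total degree [M.+1] in the two logarithms, which makes all their integrals
    scale as [n ^- M.+2]. *)
Lemma integrand_expansion_le (M : nat) : exists2 A : nat -> R,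
  (forall k, 0 <= A k) & forall (n : nat) (u : R), (0 < n)%N -> 0 < u < 1 ->
  `|f u * (1 + q * u ^+ n) `^ (w / n%:R) - f u -
    \sum_(k < M) \sum_(j < M - k) expansion_term n k.+1 j u| <=
  \sum_(k < M.+1) A k / n%:R ^+ k.+1 * log_kernel (-1) n (M - k) k.+1 u.
Proof.
have /choice[C HC] : forall J, exists c, 0 <= c /\ forall u, 0 < u <= 1 ->
    `|u * f u - \sum_(j < J) beta_coef f j * ((- ln u) ^+ j / j`!%:R)| <=
    c * (- ln u) ^+ J.
  by move=> J; have [c c0 Hc] := analytic_taylor_ln_le f_analytic J; exists c.
have C0 J : 0 <= C J by have [] := HC J.
pose X := `|w| * `|ln (1 + q)|.
have [E E0 HE] : exists2 E, 0 <= E & forall s, s <= X ->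
    `|expR s - \sum_(j < M.+1) s ^+ j / j`!%:R| <= E * `|s| ^+ M.+1.
  by apply: expR_taylor_le; rewrite mulr_ge0.
(* [C] comes from the expansion of [u * f u] and [E] from that of the exponential. In [1 + E] the 1
   serves the indices below [M] and [E] serves [k = M]. *)
exists (fun k => `|w| ^+ k.+1 * C (M - k)%N * (1 + E)).
  by move=> k; rewrite !mulr_ge0 ?exprn_ge0// addr_ge0.
move=> n u n0 u01; have /andP[u0 u1] := u01.
have u1' : 0 < u <= 1 by rewrite u0 ltW.
have v01 : 0 < u ^+ n < 1 by rewrite exprn_gt0// exprn_ilt1 ?ltW// -lt0n.
have [P0 lnle] := ln1Dq_bounds q_bounds v01.
have L0 : 0 <= - ln u by rewrite oppr_ge0 -ln1 ler_ln ?posrE// ltW.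
set l := ln (1 + q * u ^+ n) in lnle *.
set m := - ln (1 - u ^+ n) in lnle *.
have m0 : 0 <= m by exact: le_trans lnle.
pose x := w / n%:R * l.
have N0 : n%:R != 0 :> R by rewrite pnatr_eq0 -lt0n.
have Np : 0 < n%:R :> R by rewrite ltr0n.
have PE : (1 + q * u ^+ n) `^ (w / n%:R) = expR x by rewrite /powR gt_eqF.
have xX : x <= X by exact: exponent_le.
have xm k : `|x| ^+ k <= `|w| ^+ k / n%:R ^+ k * m ^+ k.
  rewrite -expr_div_n -exprMn lerXn2r ?nnegrE ?mulr_ge0 ?invr_ge0//.
  by rewrite /x !normrM normfV [`|n%:R|]ger0_norm// ler_wpM2l// mulr_ge0// invr_ge0.
pose r J := u * f u - \sum_(j < J) beta_coef f j * ((- ln u) ^+ j / j`!%:R).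
have rC J : `|r J| <= C J * (- ln u) ^+ J by have [_ H] := HC J; exact: H.
have U0 : u != 0 by rewrite gt_eqF.
have Uv : 0 <= u^-1 by rewrite invr_ge0 ltW.
(* Exact splitting of the error: each exponential term times a Taylor remainder of [u * f u], plus
   [f u] times the exponential remainder. The term of exponent 0 cancels [f u]. *)
have -> : f u * (1 + q * u ^+ n) `^ (w / n%:R) - f u -
    \sum_(k < M) \sum_(j < M - k) expansion_term n k.+1 j u =
    \sum_(k < M) x ^+ k.+1 / k.+1`!%:R / u * r (M - k)%N +
    f u * (expR x - \sum_(k < M.+1) x ^+ k / k`!%:R).
  rewrite PE big_ord_recl expr0 fact0 divr1 mulrBr mulrDr mulr1 mulr_sumr.
  have H : \sum_(k < M) \sum_(j < M - k) expansion_term n k.+1 j u =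
    \sum_(k < M) f u * (x ^+ k.+1 / k.+1`!%:R) -
    \sum_(k < M) x ^+ k.+1 / k.+1`!%:R / u * r (M - k)%N.
    rewrite -sumrB; apply: eq_bigr => k _.
    have fk0 : k.+1`!%:R != 0 :> R by rewrite pnatr_eq0 -lt0n fact_gt0.
    rewrite /r mulrBr opprB addrCA [X in _ + (_ - X)](_ : _ =
      f u * (x ^+ k.+1 / k.+1`!%:R)); last first.
      by field; rewrite ?U0 ?fk0.
    rewrite subrr addr0 mulr_sumr; apply: eq_bigr => j _.
    rewrite /expansion_term /log_kernel -/l /x !exprMn exprVn natrM.
    rewrite [(- w) ^+ _]exprNn [(- l) ^+ _]exprNn.
    have S : (-1) ^+ k.+1 * (-1) ^+ k.+1 = 1 :> R.
      by rewrite -exprD addnn -mul2n exprM sqrrN !expr1n.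
    move: ((-1) ^+ k.+1 : R) S => s S.
    have F1 : j`!%:R != 0 :> R by rewrite pnatr_eq0 -lt0n fact_gt0.
    have N1 := expf_neq0 k.+1 N0.
    move: (k.+1`!%:R : R) (j`!%:R : R) (n%:R ^+ k.+1 : R) F1 fk0 N1 => a b c F1 F2 N1.
    transitivity (s * s * (w ^+ k.+1 * beta_coef f j / (b * a) / c *
      ((- ln u) ^+ j * l ^+ k.+1 / u))); first by field; rewrite ?U0 ?N1 ?F1 ?F2.
    by rewrite S; field; rewrite ?U0 ?N1 ?F1 ?F2.
  rewrite H; move: (\sum_(k < M) _ * _) (\sum_(k < M) _ * _ * _) => s1 s2.
  by rewrite /=; ring.
rewrite [leRHS]big_ord_recr/= subnn.
apply: le_trans (ler_normD _ _) _; apply: lerD.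
  apply: le_trans (ler_norm_sum _ _ _) _; apply: ler_sum => k _.
  rewrite /log_kernel mulN1r -/m !normrM normrX.
  rewrite normfV [`|k.+1`!%:R|]ger0_norm// normfV [`|u|]gtr0_norm//.
  apply: (@le_trans _ _ ((`|w| ^+ k.+1 / n%:R ^+ k.+1 * m ^+ k.+1) * u^-1 *
      (C (M - k)%N * (- ln u) ^+ (M - k)))).
    apply: ler_pM => //; first by rewrite !mulr_ge0 ?exprn_ge0 ?Uv// ?invr_ge0.
    rewrite ler_wpM2r//; apply: le_trans (xm k.+1).
    by rewrite ler_piMr ?exprn_ge0// invf_le1 ?ler1n ?ltr0n fact_gt0.
  rewrite [leLHS](_ : _ = `|w| ^+ k.+1 * C (M - k)%N / n%:R ^+ k.+1 *
    ((- ln u) ^+ (M - k) * m ^+ k.+1 / u)); last by ring.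
  rewrite ler_wpM2r// ?mulr_ge0 ?exprn_ge0//.
  rewrite ler_wpM2r ?invr_ge0 ?exprn_ge0//.
  by rewrite ler_peMr ?mulr_ge0 ?exprn_ge0// lerDl.
rewrite /log_kernel mulN1r -/m expr0 mul1r normrM.
(* The Taylor bound of order 0 is a bound on [u * f u] itself. *)
have fC : `|f u| <= C 0%N / u.
  have := rC 0%N; rewrite /r big_ord0 subr0 expr0 mulr1 normrM (gtr0_norm u0).
  by rewrite ler_pdivlMr// mulrC.
apply: (@le_trans _ _ (C 0%N / u * (E * (`|w| ^+ M.+1 / n%:R ^+ M.+1 * m ^+ M.+1)))).
  apply: ler_pM => //; apply: le_trans (HE _ xX) _.
  by rewrite ler_wpM2l// xm.
rewrite [leLHS](_ : _ = `|w| ^+ M.+1 * C 0%N * E / n%:R ^+ M.+1 *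
  (m ^+ M.+1 / u)); last by ring.
rewrite ler_wpM2r// ?mulr_ge0 ?exprn_ge0//.
rewrite ler_wpM2r ?invr_ge0 ?exprn_ge0//.
by rewrite ler_wpM2l ?mulr_ge0 ?exprn_ge0// lerDr.
Qed.

End remainder.

Lemma integrable_cmul d (T : measurableType d) (R : realType)
    (mu : {measure set T -> \bar R}) (D : set T) (c : R) (g : T -> R) :
  measurable D -> mu.-integrable D (EFin \o g) ->
  mu.-integrable D (EFin \o (fun x => c * g x)).
Proof.
move=> mD ig; rewrite (_ : EFin \o _ = (fun x => c%:E * (EFin \o g) x)%E)//.
exact: integrableZl.
Qed.

Lemma integrable_sub d (T : measurableType d) (R : realType)
    (mu : {measure set T -> \bar R}) (D : set T) (f g : T -> R) :
  measurable D -> mu.-integrable D (EFin \o f) -> mu.-integrable D (EFin \o g) ->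
  mu.-integrable D (EFin \o (fun x => f x - g x)).
Proof.
move=> mD if_ ig; rewrite (_ : EFin \o _ = ((EFin \o f) \- (EFin \o g))%E)//.
exact: integrableB.
Qed.

Lemma log_kernel_integral (R : realType) (s : R) (n j k : nat) :
  (0 < n)%N -> -1 <= s <= 1 ->
  (@lebesgue_measure R).-integrable `]0, 1[ (EFin \o log_kernel s n j k.+1) /\
  \int[@lebesgue_measure R]_(u in `]0, 1[) log_kernel s n j k.+1 u =
  (j`! * k.+1`!)%:R / n%:R ^+ j.+1 * nielsen_polylog j.+1 k.+1 (- s).
Proof.
move=> n0 s1; split; last exact: Rintegral_lnpow_scale.
by have [] := @cvg_lnpow_integral R s j k n n0 s1.
Qed.

(** * Integration of the expansion and of its remainder *)

Section asymptotics.
Variables (R : realType) (f : R -> R) (q w : R).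
Hypothesis f_analytic : analytic_on f `[0, 1].
Hypothesis qw : (-1 < q <= 1 /\ w != 0) \/ (q = -1 /\ 0 < w).
Hypothesis f_int :
  (\int[@lebesgue_measure R]_(u in `[0%R, 1%R]) (`|f u|%R)%:E < +oo)%E.
Hypothesis fqw_int : forall n : nat, (0 < n)%N ->
  (\int[@lebesgue_measure R]_(u in `[0%R, 1%R])
     (`|f u| * (1 + q * u ^+ n) `^ (w / n%:R))%R%:E < +oo)%E.

Lemma analytic_measurable : measurable_fun (`]0, 1[%classic : set R) f.
Proof.
apply: open_continuous_measurable_fun => //.
move=> x; rewrite inE/= in_itv/= => /andP[x0 x1].
apply: differentiable_continuous; apply/derivable1_diffP.
by apply: (analytic_at_derive (f_analytic _)).1; rewrite /= in_itv/= !ltW.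
Qed.

Lemma a_coef_sumE (M n : nat) :
  \sum_(2 <= p < M.+2) a_coef f q w p / n%:R ^+ p =
  \sum_(k < M) \sum_(j < M - k)
    (- w) ^+ k.+1 * beta_coef f j * nielsen_polylog j.+1 k.+1 (- q) /
    n%:R ^+ (k.+1 + j.+1).
Proof.
rewrite -(sum_triangle (fun k j => (- w) ^+ k * beta_coef f j *
  nielsen_polylog j.+1 k (- q) / n%:R ^+ (k + j.+1))).
rewrite !big_nat; apply: eq_bigr => p /andP[p2 _].
rewrite /a_coef mulr_suml !big_nat; apply: eq_bigr => l /andP[l1 lp].
by rewrite prednK// subnK// ltnW.
Qed.

Lemma I_int_remainder_le (M : nat) : exists K, forall n, (0 < n)%N ->
  `|I_int f q w n - \int[@lebesgue_measure R]_(u in `[0, 1]) f u -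
    \sum_(2 <= p < M.+2) a_coef f q w p / n%:R ^+ p| <= K * n%:R ^- M.+2.
Proof.
have q1 : -1 <= q <= 1.
  by case: qw => [[/andP[/ltW -> ->]]|[-> _]] //; apply/andP; split; lra.
have m1 : -1 <= (-1 : R) <= 1 by apply/andP; split; lra.
have [A A0 HA] := integrand_expansion_le f_analytic qw M.
(* [c k] is the integral of the error kernel without its power of [n], namely [n ^- (M - k).+1];
   with the prefactor [n ^- k.+1] this makes [n ^- M.+2] for every [k]. *)
pose c k := ((M - k)`! * k.+1`!)%:R * nielsen_polylog (M - k).+1 k.+1 (- - 1 : R).
exists (\sum_(k < M.+1) A k * c k) => n n0.
have N0 : n%:R != 0 :> R by rewrite pnatr_eq0 -lt0n.
pose D : set (measurableTypeR R) := `]0, 1[%classic.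
have mD : measurable D by exact: measurable_itv.
pose P (u : R) := (1 + q * u ^+ n) `^ (w / n%:R).
have mf : measurable_fun D f by exact: analytic_measurable.
have mP : measurable_fun D (fun u => f u * P u).
  apply: measurable_funM => //; apply: measurable_funTS.
  apply: (measurableT_comp (measurable_powR _)).
  apply: measurable_funD => //; exact: measurable_funM.
have [if_ If] := integrable_oo_cc mf f_int.
have [ifP IfP] : (@lebesgue_measure R).-integrable D (EFin \o (fun u => f u * P u)) /\
    I_int f q w n = \int[@lebesgue_measure R]_(u in D) (f u * P u).
  apply: integrable_oo_cc => //; apply: le_lt_trans (fqw_int n0).
  rewrite le_eqVlt; apply/orP; left; apply/eqP; apply: eq_integral => u _.
  by rewrite normrM [`|P u|]ger0_norm ?powR_ge0.
have iterm k j : (@lebesgue_measure R).-integrable D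
    (EFin \o expansion_term f q w n k.+1 j).
  have [iK _] := @log_kernel_integral R q n j k n0 q1.
  by rewrite /expansion_term; exact: integrable_cmul mD iK.
have Iterm k j : \int[@lebesgue_measure R]_(u in D) expansion_term f q w n k.+1 j u =
    (- w) ^+ k.+1 * beta_coef f j * nielsen_polylog j.+1 k.+1 (- q) /
    n%:R ^+ (k.+1 + j.+1).
  have [iK IK] := @log_kernel_integral R q n j k n0 q1.
  rewrite RintegralZl// IK exprD.
  have F0 : (j`! * k.+1`!)%:R != 0 :> R by rewrite pnatr_eq0 -lt0n muln_gt0 !fact_gt0.
  move: ((j`! * k.+1`!)%:R : R) F0 => a F0.
  have := expf_neq0 k.+1 N0; have := expf_neq0 j.+1 N0.
  move: (n%:R ^+ k.+1 : R) (n%:R ^+ j.+1 : R) => b d d0 b0.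
  by field; rewrite ?F0 ?b0 ?d0.
pose S (u : R) := \sum_(k < M) \sum_(j < M - k) expansion_term f q w n k.+1 j u.
have [iS IS] : (@lebesgue_measure R).-integrable D (EFin \o S) /\
    \int[@lebesgue_measure R]_(u in D) S u =
    \sum_(2 <= p < M.+2) a_coef f q w p / n%:R ^+ p.
  have [|iS IS] := @Rintegral_bigsum _ _ R lebesgue_measure D _ (index_enum 'I_M)
    (fun k u => \sum_(j < M - k) expansion_term f q w n k.+1 j u) mD.
    by move=> k; have [] := @Rintegral_bigsum _ _ R lebesgue_measure D _
      (index_enum 'I_(M - k)) (fun j => expansion_term f q w n k.+1 j) mD (iterm k).
  split => //; rewrite IS a_coef_sumE; apply: eq_bigr => k _.
  have [_ ->] := @Rintegral_bigsum _ _ R lebesgue_measure D _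
    (index_enum 'I_(M - k)) (fun j => expansion_term f q w n k.+1 j) mD (iterm k).
  by apply: eq_bigr => j _; rewrite Iterm.
pose B (u : R) := \sum_(k < M.+1)
  A k / n%:R ^+ k.+1 * log_kernel (-1) n (M - k) k.+1 u.
have [iB IB] : (@lebesgue_measure R).-integrable D (EFin \o B) /\
    \int[@lebesgue_measure R]_(u in D) B u =
    (\sum_(k < M.+1) A k * c k) * n%:R ^- M.+2.
  have iK (k : 'I_M.+1) := (@log_kernel_integral R (-1) n (M - k) k n0 m1).1.
  have [|iB IB] := @Rintegral_bigsum _ _ R lebesgue_measure D _ (index_enum 'I_M.+1)
    (fun k u => A k / n%:R ^+ k.+1 * log_kernel (-1) n (M - k) k.+1 u) mD.
    by move=> k; exact: (@integrable_cmul _ _ R _ _ (A k / n%:R ^+ k.+1) _ mD (iK k)).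
  split => //; rewrite IB mulr_suml; apply: eq_bigr => k _.
  rewrite (RintegralZl _ mD (iK k)).
  rewrite (@log_kernel_integral R (-1) n (M - k) k n0 m1).2 /c.
  have -> : M.+2 = (k.+1 + (M - k).+1)%N by rewrite addnS addSn subnKC// -ltnS.
  rewrite exprD; have := expf_neq0 k.+1 N0; have := expf_neq0 (M - k).+1 N0.
  move: (n%:R ^+ k.+1 : R) (n%:R ^+ (M - k).+1 : R) => b d d0 b0.
  by field; rewrite ?b0 ?d0.
have iR : (@lebesgue_measure R).-integrable D
    (EFin \o (fun u => f u * P u - f u - S u)).
  exact: (integrable_sub mD (integrable_sub mD ifP if_) iS).
rewrite IfP If -IS -!RintegralB//; last first.
  exact: (integrable_sub mD ifP if_).
apply: le_trans (le_normr_Rintegral mD iR) _.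
rewrite -IB; apply: le_Rintegral => //.
  exact: integrable_norm.
move=> u; rewrite /D/= in_itv/= => u01; exact: HA.
Qed.

Lemma I_int_asymptotic : asymptotic_expansion (I_int f q w)
  (\int[@lebesgue_measure R]_(u in `[0, 1]) f u) (a_coef f q w).
Proof.
case=> [|M] // M1; have [K HK] := I_int_remainder_le M.
(* The constant of a big O must be positive, which [K] need not be. *)
apply/eqO_exP; exists (Num.max 1 K); first by rewrite lt_max ltr01.
near=> n; have n0 : (0 < n)%N by near: n; exact: nbhs_infty_gt.
apply: le_trans (HK n n0) _.
rewrite normfV [`|n%:R ^+ _|]ger0_norm ?exprn_ge0//.
by rewrite ler_wpM2r ?invr_ge0 ?exprn_ge0// le_max lexx orbT.
Unshelve. all: by end_near. Qed.

End asymptotics.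

Unset Implicit Arguments.

Theorem theorem2p4 (R : realType) (f : R -> R) (q w : R)
  (f_analytic : analytic_on f `[0, 1])
  (qw : (-1 < q <= 1 /\ w != 0) \/ (q = -1 /\ 0 < w))
  (f_int : (\int[@lebesgue_measure R]_(u in `[0%R, 1%R]) (`|f u|%R)%:E < +oo)%E)
  (fqw_int : forall n : nat, (0 < n)%N ->
    (\int[@lebesgue_measure R]_(u in `[0%R, 1%R])
       (`|f u| * (1 + q * u ^+ n) `^ (w / n%:R))%R%:E < +oo)%E) :
  asymptotic_expansion (I_int f q w)
    (\int[@lebesgue_measure R]_(u in `[0, 1]) f u) (a_coef f q w) /\
  (q = -1 -> forall p : nat, (2 <= p)%N ->
     a_coef f q w p =
     \sum_(1 <= l < p) (- w) ^+ (p - l) * beta_coef f l.-1 *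
       mzv R ((false, l.+1) :: nseq (p - l).-1 (false, 1%N))) /\
  (q = 1 -> forall p : nat, (2 <= p)%N ->
     a_coef f q w p =
     \sum_(1 <= l < p) (- w) ^+ (p - l) * beta_coef f l.-1 *
       mzv R ((true, l.+1) :: nseq (p - l).-1 (false, 1%N))).
Proof.
split; first exact: I_int_asymptotic.
(* The polylogarithm is taken at [- q], so [q = -1] gives unbarred zeta values and [q = 1] barred
   ones. *)
have zeta b : - q = (if b then -1 else 1) -> forall p : nat, (2 <= p)%N ->
    a_coef f q w p =
    \sum_(1 <= l < p) (- w) ^+ (p - l) * beta_coef f l.-1 *
      mzv R ((b, l.+1) :: nseq (p - l).-1 (false, 1%N)).
  move=> qb p _; rewrite /a_coef qb !big_nat; apply: eq_bigr => l /andP[l1 lp].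
  rewrite -[in RHS](prednK l1) mzv_nielsen_polylog !prednK// subn_gt0//.
by split => qE; [apply: (zeta false)|apply: (zeta true)]; rewrite qE ?opprK.
Qed.
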